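(* There exists an absolute constant $C$ (not depending on $n$, $r$ or $H$) such that the following holds. Let $H\in\mathbb{R}^{n\times n}$ be a symmetric matrix with $r:=\operatorname{rank}(H)$. Let $M$ be a positive integer, let $u_1,\dots,u_M,v_1,\dots,v_M$ be independent random vectors each uniformly distributed on the unit sphere $\mathbb{S}^{n-1}\subset\mathbb{R}^n$, and define the linear maps $\mathcal{P}_i:A\mapsto n^2 u_iu_i^\top A v_iv_i^\top$ on $\mathbb{R}^{n\times n}$ and $\mathcal{S}:=\frac1M\sum_{i=1}^M\mathcal{P}_i$. If $M\ge C\, n r^2\log^2(n)$, then with probability larger than $1-\frac1n$, the solution $\widehat H$ of the convex program $$\min_{\widehat H\in\mathbb{R}^{n\times n}}\|\widehat H\|_1\quad\text{subject to}\quad \mathcal{S}\widehat H=\mathcal{S}H$$ satisfies $\widehat H=H$ (that is, $H$ is the only minimizer).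
   Context: $\|\cdot\|_1$ denotes the trace norm (Schatten $1$-norm, the sum of singular values). $\log^2(n)$ means $(\log n)^2$. *)

(* Defs.v *)
From HB Require Import structures.
From mathcomp Require Import all_boot all_order all_algebra polyrcf.
From mathcomp Require Import all_classical all_reals all_analysis.

Set Implicit Arguments.
Unset Strict Implicit.
Unset Printing Implicit Defensive.

Import Order.TTheory GRing.Theory Num.Theory.
Import numFieldNormedType.Exports.

Local Open Scope classical_set_scope.
Local Open Scope ring_scope.

(* Mathematical Components / MathComp-Analysis, over an arbitrary realType. *)

(* The square roots of the eigenvalues of A^T A, each repeated according to its
   multiplicity as a root of the characteristic polynomial; [rootsR] lists the
   distinct real roots, and all the roots are real because A^T A is symmetric
   positive semidefinite. *)
Definition singular_values (R : realType) (m n : nat) (A : 'M[R]_(m, n)) :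
    seq R :=
  let p := char_poly (A^T *m A) in
  [seq Num.sqrt x | x <- flatten [seq nseq (mup x p) x | x <- rootsR p]].

Definition trace_norm (R : realType) (m n : nat) (A : 'M[R]_(m, n)) : R :=
  \sum_(s <- singular_values A) s.

(* R^n as column vectors, with the Borel sigma-algebra. *)
Definition borel_cV (R : realType) (n : nat) :=
  g_sigma_algebraType (@open 'cV[R]_n).

(* The Euclidean sphere: the library norm on matrices is the max norm. *)
Definition unit_sphere (R : realType) (n : nat) : set (borel_cV R n) :=
  [set x : 'cV[R]_n | \sum_(i < n) x i 0 ^+ 2 = 1].

(* The uniform distribution on the sphere is the unique Borel probability
   measure carried by the sphere that is invariant under the orthogonal
   group. *)
Definition uniform_on_sphere (R : realType) (n : nat)
    (mu : probability (borel_cV R n) R) : Prop :=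
  mu (@unit_sphere R n) = 1%E /\
  forall Q : 'M[R]_n, Q^T *m Q = 1%:M ->
  forall B : set (borel_cV R n), measurable B ->
    mu [set x : borel_cV R n | B (Q *m (x : 'cV[R]_n))] = mu B.

Definition mutually_independent (R : realType) (d d' : measure_display)
    (Omega : measurableType d) (T : measurableType d')
    (P : probability Omega R) (I : finType) (X : I -> {RV P >-> T}) : Prop :=
  forall (J : {set I}) (B : I -> set T), (forall i, measurable (B i)) ->
    P (\bigcap_(i in [set` J]) (X i @^-1` B i)) =
    (\prod_(i in J) P (X i @^-1` B i))%E.

(* Mutual independence of u_1, ..., u_M, v_1, ..., v_M as a single family. *)
Definition joint_family (T : Type) (M : nat) (u v : 'I_M -> T)
    (k : 'I_M + 'I_M) : T :=
  match k with inl i => u i | inr i => v i end.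

Definition rank_one_map (R : realType) (n : nat) (u v : 'cV[R]_n)
    (A : 'M[R]_n) : 'M[R]_n :=
  n%:R ^+ 2 *: (u *m u^T *m A *m (v *m v^T)).

Definition sampling_map (R : realType) (n M : nat) (u v : 'I_M -> 'cV[R]_n)
    (A : 'M[R]_n) : 'M[R]_n :=
  M%:R^-1 *: \sum_(i < M) rank_one_map (u i) (v i) A.

Definition is_minimizer (R : realType) (n : nat) (S : 'M[R]_n -> 'M[R]_n)
    (H X : 'M[R]_n) : Prop :=
  S X = S H /\
  forall Y : 'M[R]_n, S Y = S H -> trace_norm X <= trace_norm Y.

(* Main.v *)
(* With f(A) = sum_i n |u_i^T A v_i|, the kernel of S is the zero set of f, so it
   suffices that f vanishes at no Z <> 0 with |H + Z|_1 <= |H|_1.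
   If f(A) is comparable to M |A|_F on matrices of rank O(r), this follows from
   the usual cone argument: subgradients of the trace norm at H bound the trace
   norm of the part of Z orthogonal to the row and column spaces of H by
   sqrt(r) |Z|_F; cutting the sorted singular values of that part into blocks of
   length K r leaves a tail too small to cancel f on the head.
   For a fixed A, reflecting coordinates replaces integrals over the sphere by
   averages over signs, which bounds the exponential moments of n u^T A v;
   together with E (n u^T A v)^2 = |A|_F^2, a Chernoff bound in both directions
   gives f(A) ~ M |A|_F outside probability 2 exp(- c M).  A grid of
   n^(O(n r)) factorizations X Y^T extends this to all matrices of rank O(r), and
   the union bound costs only a factor exp(O(n r log n)). *)

Require Import Defs.
From HB Require Import structures.
From mathcomp Require Import all_boot all_order all_algebra polyrcf.
From mathcomp Require Import all_classical all_reals all_analysis.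
From mathcomp Require Import measurable_realfun.
From mathcomp Require Import ring lra zify.

Set Implicit Arguments.
Unset Strict Implicit.
Unset Printing Implicit Defensive.

Import Order.TTheory GRing.Theory Num.Theory.
Import numFieldNormedType.Exports.

Local Open Scope classical_set_scope.
Local Open Scope ring_scope.

(** * Orthogonal matrices and the singular value decomposition *)

(** The absolute values in f answer to the tails. Uniformly in n, n u^T A v is only subexponential,
    so its square has no exponential moment and the quadratic form of S could not be bounded above
    outside probability exp(- c M), as a union over a grid demands; the absolute value can. Being
    subadditive, f also lets the blocks of the tail be summed. Exponential moments on the sphere are
    obtained without densities or Gaussian comparison. A rotation first turns the linear form into
    one with equal coefficients; the signed terms then have a sum of squares that is constant on the
    sphere, whatever the point. Two things need work beyond the estimates. Independence is given on
    events, so the product formula for expectations is built from rectangles. Recovery quantifies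
    over all matrices, so its measurability is proved through compact pieces and rational matrices.
    The cases n = 1 and H = 0 stand apart because the required lower bound on M is then 0. *)

Section linear_algebra.
Variable R : realType.
Implicit Types n : nat.

Definition dotv n (x y : 'cV[R]_n) : R := \sum_i x i 0 * y i 0.
Definition sqn n (x : 'cV[R]_n) : R := \sum_i x i 0 ^+ 2.
Definition frob2 m n (A : 'M[R]_(m, n)) : R := \sum_i \sum_j A i j ^+ 2.

Lemma sqnE n (x : 'cV[R]_n) : sqn x = dotv x x.
Proof. by apply: eq_bigr => i _; rewrite expr2. Qed.

Lemma sqn_ge0 n (x : 'cV[R]_n) : 0 <= sqn x.
Proof. by apply: sumr_ge0 => i _; exact: sqr_ge0. Qed.

Lemma sqn_eq0 n (x : 'cV[R]_n) : (sqn x == 0) = (x == 0).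
Proof.
apply/eqP/eqP => [x0|->]; last by rewrite /sqn big1// => i _; rewrite mxE expr0n.
apply/colP => i; rewrite mxE; apply/eqP; rewrite -sqrf_eq0.
have /psumr_eq0P -> // : \sum_i x i 0 ^+ 2 = 0 by [].
by move=> j _; exact: sqr_ge0.
Qed.

Lemma dotvC n (x y : 'cV[R]_n) : dotv x y = dotv y x.
Proof. by apply: eq_bigr => i _; rewrite mulrC. Qed.

Lemma dotvE n (x y : 'cV[R]_n) : x^T *m y = (dotv x y)%:M.
Proof.
apply/matrixP => i j; rewrite !ord1 !mxE eqxx mulr1n.
by apply: eq_bigr => k _; rewrite mxE.
Qed.

Lemma dotvE00 n (x y : 'cV[R]_n) : dotv x y = (x^T *m y) 0 0.
Proof. by rewrite dotvE mxE eqxx mulr1n. Qed.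

Lemma dotvDl n (x y z : 'cV[R]_n) : dotv (x + y) z = dotv x z + dotv y z.
Proof. by rewrite -big_split; apply: eq_bigr => i _; rewrite mxE mulrDl. Qed.

Lemma dotvZl n a (x z : 'cV[R]_n) : dotv (a *: x) z = a * dotv x z.
Proof. by rewrite mulr_sumr; apply: eq_bigr => i _; rewrite mxE mulrA. Qed.

Lemma dotvDr n (x y z : 'cV[R]_n) : dotv z (x + y) = dotv z x + dotv z y.
Proof. by rewrite dotvC dotvDl !(dotvC z). Qed.

Lemma dotvZr n a (x z : 'cV[R]_n) : dotv z (a *: x) = a * dotv z x.
Proof. by rewrite dotvC dotvZl (dotvC z). Qed.

Lemma dotvMl n m (A : 'M[R]_(m, n)) (x : 'cV[R]_n) (y : 'cV[R]_m) :
  dotv (A *m x) y = dotv x (A^T *m y).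
Proof. by rewrite !dotvE00 trmx_mul mulmxA. Qed.

Lemma sqnD n (x y : 'cV[R]_n) : sqn (x + y) = sqn x + 2 * dotv x y + sqn y.
Proof. rewrite !sqnE !(dotvDl, dotvDr) (dotvC y x); ring. Qed.

Lemma sqnZ n a (x : 'cV[R]_n) : sqn (a *: x) = a ^+ 2 * sqn x.
Proof. by rewrite !sqnE dotvZl dotvZr mulrA expr2. Qed.

Lemma orthoC n (Q : 'M[R]_n) : Q^T *m Q = 1%:M -> Q *m Q^T = 1%:M.
Proof. exact: mulmx1C. Qed.

Lemma orthoT n (Q : 'M[R]_n) : Q^T *m Q = 1%:M -> Q^T^T *m Q^T = 1%:M.
Proof. by move=> /orthoC; rewrite trmxK. Qed.

Lemma orthoM n (Q P : 'M[R]_n) : Q^T *m Q = 1%:M -> P^T *m P = 1%:M ->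
  (Q *m P)^T *m (Q *m P) = 1%:M.
Proof.
by move=> Q1 P1; rewrite trmx_mul mulmxA -(mulmxA P^T) Q1 mulmx1.
Qed.

Lemma dotv_ortho n (Q : 'M[R]_n) x y : Q^T *m Q = 1%:M ->
  dotv (Q *m x) (Q *m y) = dotv x y.
Proof. by move=> Q1; rewrite dotvMl mulmxA Q1 mul1mx. Qed.

Lemma sqn_ortho n (Q : 'M[R]_n) x : Q^T *m Q = 1%:M -> sqn (Q *m x) = sqn x.
Proof. by move=> Q1; rewrite !sqnE dotv_ortho. Qed.

(** The reflection in the hyperplane orthogonal to x - y exchanges two vectors of equal length. It
    serves both [svd] and the rotation invariance of sphere integrals. *)
Lemma householder n (x y : 'cV[R]_n) : sqn x = sqn y ->
  exists Q : 'M[R]_n, Q^T *m Q = 1%:M /\ Q *m x = y.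
Proof.
move=> xy; have [->|nxy] := eqVneq x y.
  by exists 1%:M; rewrite trmx1 !mul1mx.
pose w := x - y; have w0 : sqn w != 0 by rewrite sqn_eq0 subr_eq0.
have wx : 2 * dotv w x = sqn w.
  have : sqn y = sqn (x + - w) by congr sqn; rewrite /w opprB addrC subrK.
  rewrite sqnD -scaleN1r dotvZr sqnZ dotvC; lra.
pose Q := 1%:M - (2 / sqn w) *: (w *m w^T).
have QT : Q^T = Q.
  by rewrite /Q linearB /= linearZ /= trmx_mul trmxK trmx1.
exists Q; split.
  rewrite QT /Q mulmxBl mul1mx mulmxBr mulmx1 -scalemxAl -!scalemxAr.
  rewrite mulmxA -(mulmxA w) dotvE -sqnE mul_mx_scalar -scalemxAl !scalerA.
  set W := w *m w^T.
  have -> : 2 / sqn w * (2 / sqn w * sqn w) = 2 / sqn w + 2 / sqn w by field.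
  by rewrite scalerDl; set a := _ *: W; rewrite opprB addrK subrK.
rewrite /Q mulmxBl mul1mx -scalemxAl -mulmxA dotvE mul_mx_scalar scalerA.
have -> : 2 / sqn w * dotv w x = 1.
  by rewrite mulrAC wx divff.
by rewrite scale1r /w opprB addrCA subrr addr0.
Qed.

Lemma continuous_sumr (T : topologicalType) (I : Type) (r : seq I)
    (F : I -> T -> R) : (forall i, continuous (F i)) ->
  continuous (fun x => \sum_(i <- r) F i x).
Proof.
move=> cF; elim: r => [|i r IH].
  by under eq_fun do rewrite big_nil; exact: cst_continuous.
under eq_fun do rewrite big_cons.
by move=> x; apply: continuousD; [exact: cF|exact: IH].
Qed.

Lemma continuous_exprn (T : topologicalType) (f : T -> R) k :
  continuous f -> continuous (fun x => f x ^+ k).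
Proof.
move=> cf x; apply: (@continuous_comp _ _ _ f (fun y => y ^+ k)); first exact: cf.
exact: exprn_continuous.
Qed.

Lemma continuous_mulr (T : topologicalType) (f g : T -> R) :
  continuous f -> continuous g -> continuous (fun x => f x * g x).
Proof. by move=> cf cg x; apply: continuousM; [exact: cf|exact: cg]. Qed.

Lemma compact_rV n (A : set 'rV[R]_n) (b : R) :
  closed A -> (forall v, A v -> forall i, `|v 0 i| <= b) -> compact A.
Proof.
move=> Acl Ab; apply: bounded_closed_compact => //.
exists (Num.max b 0); split; first by rewrite num_real.
move=> x bx v /Ab vb; rewrite /= [leLHS]/Num.norm /= mx_normrE; apply: bigmax_le => /=.
  by apply/ltW/(le_lt_trans _ bx); rewrite le_max lexx orbT.
move=> [i j] _ /=; rewrite ord1; apply: (le_trans (vb j)).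
by apply/ltW/(le_lt_trans _ bx); rewrite le_max lexx.
Qed.

(** By compactness |A w| attains its maximum on the sphere; the maximizer is a top right singular
    vector, which [svd] splits off. *)
Lemma sphere_max n (A : 'M[R]_n.+1) : exists y : 'cV[R]_n.+1, sqn y = 1 /\
  forall w, sqn (A *m w) <= sqn (A *m y) * sqn w.
Proof.
pose K := [set v : 'rV[R]_n.+1 | sqn v^T = 1].
have cc (i : 'I_n.+1) : continuous (fun v : 'rV[R]_n.+1 => v 0 i).
  exact: coord_continuous.
have cK : continuous (fun v : 'rV[R]_n.+1 => sqn v^T).
  apply: continuous_sumr => i; apply: continuous_exprn.
  under eq_fun do rewrite mxE; exact: cc.
have Kcl : closed K.
  by move/continuous_closedP : cK => /(_ [set 1]); apply; exact: closed_eq.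
have Kb v : K v -> forall i, `|v 0 i| <= 1.
  move=> Kv i; rewrite -(@expr_le1 _ 2)// real_normK ?num_real//.
  rewrite -Kv /sqn (bigD1 i)//= mxE lerDl.
  by apply: sumr_ge0 => j _; exact: sqr_ge0.
have Kc : compact K := compact_rV Kcl Kb.
have K0 : K !=set0.
  exists (delta_mx 0 0); rewrite /K /= /sqn (bigD1 0)//= big1 ?addr0.
    by rewrite !mxE !eqxx expr1n.
  by move=> i i0; rewrite !mxE (negbTE i0) expr0n.
have cf : continuous (fun v : 'rV[R]_n.+1 => sqn (A *m v^T)).
  apply: continuous_sumr => i; apply: continuous_exprn.
  under eq_fun do rewrite mxE; apply: continuous_sumr => j.
  apply: continuous_mulr; first exact: cst_continuous.
  by under eq_fun do rewrite mxE; exact: cc.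
have [y /set_mem Ky ymax] := compact_EVT_max K0 Kc (continuous_subspaceT cf).
exists y^T; split => // w.
have [->|w0] := eqVneq w 0.
  have sqn0 m : sqn (0 : 'cV[R]_m) = 0 by apply/eqP; rewrite sqn_eq0.
  by rewrite mulmx0 !sqn0 mulr0.
have sw : 0 < sqn w by rewrite lt_def sqn_eq0 w0 sqn_ge0.
pose a := Num.sqrt (sqn w).
have a0 : 0 < a by rewrite sqrtr_gt0.
have a2 : a ^+ 2 = sqn w by rewrite sqr_sqrtr// ltW.
have Kw : K (a^-1 *: w)^T.
  by rewrite /K /= trmxK sqnZ exprVn a2 mulVf// gt_eqF.
have := ymax _ (mem_set Kw); rewrite trmxK -scalemxAr sqnZ exprVn a2.
by rewrite mulrC ler_pdivrMr.
Qed.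

Lemma sqn_col_mx m n (x : 'cV[R]_m) (y : 'cV[R]_n) :
  sqn (col_mx x y) = sqn x + sqn y.
Proof.
by rewrite /sqn big_split_ord; congr (_ + _); apply: eq_bigr => i _;
  rewrite ?col_mxEu ?col_mxEd.
Qed.

(** Reflections send the first basis vector to the maximizer and to its normalized image. In these
    bases A is block diagonal, and induction applies to the lower block. The singular values come
    out unsorted; sorting is left to the user. *)
Lemma svd n (A : 'M[R]_n) : exists U V (s : 'rV[R]_n),
  [/\ U^T *m U = 1%:M, V^T *m V = 1%:M, forall i, 0 <= s 0 i &
      A = U *m diag_mx s *m V^T].
Proof.
elim: n A => [|n IH] A.
  exists 1%:M, 1%:M, 0; split; rewrite ?trmx1 ?mulmx1//.
    by move=> i; rewrite mxE.
  by rewrite [LHS]flatmx0 [RHS]flatmx0.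
have [y [y1 ymax]] := sphere_max A.
have [Ay0|Ay0] := eqVneq (sqn (A *m y)) 0.
  exists 1%:M, 1%:M, 0; split; rewrite ?trmx1 ?mulmx1//.
    by move=> i; rewrite mxE.
  apply/matrixP => i j; rewrite linear0 mulmx0 mxE.
  have : sqn (A *m delta_mx j 0) == 0.
    rewrite eq_le sqn_ge0 andbT; apply: le_trans (ymax _) _.
    by rewrite Ay0 mul0r.
  by rewrite sqn_eq0 -colE => /eqP/colP/(_ i); rewrite !mxE.
pose sg := Num.sqrt (sqn (A *m y)).
have sg2 : sg ^+ 2 = sqn (A *m y) by rewrite sqr_sqrtr// sqn_ge0.
have sg0 : 0 < sg by rewrite sqrtr_gt0 lt_def Ay0 sqn_ge0.
pose e0 : 'cV[R]_n.+1 := delta_mx 0 0.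
have e01 : sqn e0 = 1.
  rewrite /sqn (bigD1 0)//= big1 ?addr0; first by rewrite !mxE !eqxx expr1n.
  by move=> i i0; rewrite !mxE (negbTE i0) expr0n.
have [|Q2 [Q2o Q2e]] := @householder _ e0 y; first by rewrite e01 y1.
have [|Q1 [Q1o Q1e]] := @householder _ e0 (sg^-1 *: (A *m y)).
  by rewrite e01 sqnZ exprVn sg2 mulVf.
pose B0 := Q1^T *m A *m Q2; pose B : 'M[R]_(1 + n) := B0.
have Bmax w : sqn (B0 *m w) <= sg ^+ 2 * sqn w.
  rewrite /B0 -!mulmxA sqn_ortho; last exact: orthoT.
  by rewrite sg2 -(sqn_ortho w Q2o); exact: ymax.
have Be : B0 *m e0 = sg *: e0.
  rewrite /B0 -mulmxA Q2e -mulmxA.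
  have -> : A *m y = sg *: (Q1 *m e0).
    by rewrite Q1e scalerA divff ?scale1r// gt_eqF.
  by rewrite -scalemxAr mulmxA Q1o mul1mx.
have Bi0 (i : 'I_n.+1) : B0 i 0 = sg * (i == 0)%:R.
  have : (B0 *m e0) i 0 = (sg *: e0) i 0 by rewrite Be.
  by rewrite /e0 -colE [LHS]mxE [RHS]mxE [X in _ * X]mxE andbT.
have Bul : ulsubmx B = sg%:M.
  apply/matrixP => i j; rewrite !ord1 mxE mxE [RHS]mxE eqxx mulr1n.
  transitivity (B0 0 0); last by rewrite Bi0 eqxx mulr1.
  by congr (B0 _ _); apply: val_inj.
have Bdl : dlsubmx B = 0.
  apply/matrixP => i j; rewrite !ord1 mxE mxE [RHS]mxE.
  transitivity (B0 (rshift 1 i) 0); last by rewrite Bi0 mulr0.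
  by congr (B0 _ _); apply: val_inj.
(* If the rest c of the first row were nonzero, the vector (sg, c) would beat the maximum: its image
   has first entry sg^2 + |c|^2, while its own squared length is only sg^2 + |c|^2. *)
have Bur : ursubmx B = 0.
  pose c := (ursubmx B)^T; pose w : 'cV[R]_(1 + n) := col_mx sg%:M c.
  have sqs : sqn (sg%:M : 'cV[R]_1) = sg ^+ 2.
    by rewrite /sqn big_ord1 mxE eqxx mulr1n.
  have Bw : B *m w = col_mx (sg ^+ 2 + sqn c)%:M (drsubmx B *m c).
    rewrite -[B in LHS]submxK Bul Bdl /w mul_block_col mul0mx add0r.
    by rewrite -{1}(trmxK (ursubmx B)) -/c dotvE -sqnE -scalar_mxM -expr2 -raddfD.
  have sqa (a : R) : sqn (a%:M : 'cV[R]_1) = a ^+ 2.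
    by rewrite /sqn big_ord1 mxE eqxx mulr1n.
  have h : sqn (B *m w) <= sg ^+ 2 * sqn w := Bmax w.
  rewrite Bw !sqn_col_mx !sqa in h.
  have h2 := sqn_ge0 c; have h1 := sqn_ge0 (drsubmx B *m c).
  have : sqn c = 0.
    have : sqn c * sg ^+ 2 <= 0.
      have := mulr_ge0 h2 h2; lra.
    have : 0 < sg ^+ 2 by rewrite exprn_gt0.
    nra.
  by move/eqP; rewrite sqn_eq0 => /eqP c0; rewrite -[LHS]trmxK -/c c0 trmx0.
have [U [V [s [Uo Vo s0 Bdr]]]] := IH (drsubmx B).
pose U1 : 'M[R]_(1 + n) := block_mx 1%:M 0 0 U.
pose V1 : 'M[R]_(1 + n) := block_mx 1%:M 0 0 V.
have block_o (W : 'M[R]_n) : W^T *m W = 1%:M ->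
    (block_mx 1%:M 0 0 W : 'M[R]_(1 + n))^T *m block_mx 1%:M 0 0 W = 1%:M.
  move=> Wo; rewrite tr_block_mx mulmx_block !trmx0 !trmx1 !mulmx0 !mul0mx.
  by rewrite mulmx1 Wo !addr0 !add0r -scalar_mx_block.
exists (Q1 *m U1), (Q2 *m V1), (row_mx sg%:M s); split.
- by apply: orthoM => //; exact: block_o.
- by apply: orthoM => //; exact: block_o.
- move=> i; case: (@split_ordP 1 n i) => j ->.
    by rewrite (@row_mxEl _ 1 1 n) !ord1 mxE eqxx mulr1n ltW.
  by rewrite (@row_mxEr _ 1 1 n).
have BE : B = U1 *m (block_mx sg%:M 0 0 (diag_mx s) : 'M[R]_(1 + n)) *m V1^T.
  rewrite /U1 /V1 tr_block_mx !mulmx_block !trmx0 !trmx1 !mulmx0 !mul0mx.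
  rewrite mulmx1 mul1mx !addr0 !add0r -Bdr -Bul.
  by rewrite !mul0mx -[LHS]submxK Bur Bdl.
have DE : block_mx sg%:M 0 0 (diag_mx s) = diag_mx (row_mx sg%:M s) :> 'M[R]_(1 + n).
  by rewrite diag_mx_row; congr block_mx; apply/matrixP => i j; rewrite !ord1 !mxE eqxx.
have AE : A = Q1 *m B *m Q2^T.
  by rewrite /B /B0 !mulmxA (orthoC Q1o) mul1mx -mulmxA (orthoC Q2o) mulmx1.
rewrite DE in BE; rewrite [LHS]AE BE; clear.
have gen m (X Y Z T W : 'M[R]_m) :
  X *m (Y *m Z *m T^T) *m W^T = X *m Y *m Z *m (W *m T)^T.
  by rewrite trmx_mul !mulmxA.
exact: gen.
Qed.

End linear_algebra.

(** * The trace norm *)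

Section trace_norm.
Variable R : realType.
Implicit Types n : nat.

Lemma char_poly_conj n (B V : 'M[R]_n) : V^T *m V = 1%:M ->
  char_poly (V *m B *m V^T) = char_poly B.
Proof.
move=> Vo; rewrite /char_poly.
have -> : char_poly_mx (V *m B *m V^T) =
    map_mx polyC V *m char_poly_mx B *m map_mx polyC V^T.
  rewrite /char_poly_mx mulmxBr mulmxBl -!map_mxM; congr (_ - _).
  by rewrite mul_mx_scalar -scalemxAl -map_mxM (orthoC Vo) map_mx1 scalemx1.
by rewrite !det_mulmx mulrC mulrA -det_mulmx -map_mxM Vo map_mx1 det1 mul1r.
Qed.

Lemma mup_prod_XsubC (a : seq R) x :
  mup x (\prod_(y <- a) ('X - y%:P)) = count_mem x a.
Proof.
elim: a => [|y a IH].
  by rewrite big_nil mupNroot// rootC oner_eq0.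
rewrite big_cons mupM ?polyXsubC_eq0//; last first.
  by rewrite monic_neq0// monic_prod_XsubC.
by rewrite -['X - y%:P]expr1 mup_XsubCX IH /=; case: eqP.
Qed.

(** On a split polynomial, the distinct roots repeated by multiplicity are the original list up to
    order; this ties [singular_values] to any SVD. *)
Lemma perm_rootsR (a : seq R) (p := \prod_(y <- a) ('X - y%:P)) :
  perm_eq (flatten [seq nseq (mup x p) x | x <- rootsR p]) a.
Proof.
have p0 : p != 0 by rewrite monic_neq0// monic_prod_XsubC.
apply/allP => x _ /=; apply/eqP; rewrite count_flatten -map_comp sumnE big_map.
under eq_bigr do rewrite /= count_nseq /= mup_prod_XsubC.
have -> : (\sum_(y <- rootsR p) (y == x) * count_mem y a =
    (x \in rootsR p) * count_mem x a)%N.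
  have : uniq (rootsR p) by exact: uniq_roots.
  elim: (rootsR p) => [|y s IH] /=; first by rewrite big_nil.
  move=> /andP[ys us]; rewrite big_cons IH// in_cons.
  case: (eqVneq y x) ys => [->|yx] ys; last by [].
  by rewrite (negbTE ys) /= mul0n addn0.
have := roots_on_rootsR p0 x; rewrite in_itv /= => <-.
case: (boolP (root p x)) => [_|]; first by rewrite mul1n.
by rewrite root_prod_XsubC mul0n => /count_memPn ->.
Qed.

Lemma trace_norm_svd n (U V : 'M[R]_n) (s : 'rV[R]_n) :
  U^T *m U = 1%:M -> V^T *m V = 1%:M -> (forall i, 0 <= s 0 i) ->
  trace_norm (U *m diag_mx s *m V^T) = \sum_i s 0 i.
Proof.
move=> Uo Vo s0; rewrite /trace_norm /singular_values.
have -> : (U *m diag_mx s *m V^T)^T *m (U *m diag_mx s *m V^T) =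
    V *m diag_mx (\row_i s 0 i ^+ 2) *m V^T.
  rewrite !trmx_mul trmxK tr_diag_mx !mulmxA -(mulmxA _ U^T) Uo mulmx1.
  congr (_ *m _); rewrite -mulmxA; congr (_ *m _).
  by rewrite mulmx_diag; congr diag_mx; apply/rowP => i; rewrite !mxE expr2.
rewrite char_poly_conj// char_poly_trig ?diag_mx_is_trig//.
pose a := [seq s 0 i ^+ 2 | i : 'I_n].
have -> : \prod_(i < n) ('X - (diag_mx (\row_i s 0 i ^+ 2) i i)%:P) =
    \prod_(y <- a) ('X - y%:P) :> {poly R}.
  rewrite big_image /=; apply: eq_bigr => i _.
  by rewrite !mxE eqxx mulr1n.
rewrite big_map (perm_big _ (perm_rootsR a)) big_image /=.
by apply: eq_bigr => i _; rewrite sqrtr_sqr ger0_norm.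
Qed.

(* Operator norm at most 1. *)
Definition contraction n (W : 'M[R]_n) :=
  forall x y : 'cV[R]_n, 2 * dotv x (W *m y) <= sqn x + sqn y.

Lemma contraction_ortho n (W : 'M[R]_n) : W^T *m W = 1%:M -> contraction W.
Proof.
move=> Wo x y; rewrite -(sqn_ortho y Wo).
have := sqn_ge0 (x + (-1) *: (W *m y)).
by rewrite sqnD dotvZr sqnZ; lra.
Qed.

Lemma dotv_col m n (A B : 'M[R]_(m, n)) i j :
  dotv (col i A) (col j B) = (A^T *m B) i j.
Proof. by rewrite mxE; apply: eq_bigr => k _; rewrite !mxE. Qed.

Lemma sqn_col_ortho n (U : 'M[R]_n) i : U^T *m U = 1%:M -> sqn (col i U) = 1.
Proof.
move=> Uo; rewrite colE sqn_ortho// /sqn (bigD1 i)//= big1 ?addr0.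
  by rewrite !mxE !eqxx expr1n.
by move=> j ji; rewrite !mxE (negbTE ji) expr0n.
Qed.

Lemma mxtrace_diag_mul n (s : 'rV[R]_n) (B : 'M[R]_n) :
  \tr (diag_mx s *m B) = \sum_i s 0 i * B i i.
Proof. by apply: eq_bigr => i _; rewrite mul_diag_mx mxE. Qed.

(** In an SVD of A the pairing is the sum of s_i <u_i, W v_i>, and a contraction keeps each
    coefficient at most 1. Both the subgradient inequality and the continuity of the trace norm rest
    on this. *)
Lemma trace_norm_dual n (W A : 'M[R]_n) : contraction W ->
  \tr (W^T *m A) <= trace_norm A.
Proof.
move=> Wc; have [U [V [s [Uo Vo s0 ->]]]] := svd A.
rewrite trace_norm_svd// mxtrace_mulC -!mulmxA mxtrace_mulC -!mulmxA mxtrace_diag_mul.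
apply: ler_sum => i _; rewrite ler_piMr//.
have -> : (V^T *m (W^T *m U)) i i = dotv (col i U) (W *m col i V).
  have -> : W *m col i V = col i (W *m V) by rewrite !colE mulmxA.
  rewrite dotv_col.
  transitivity ((U^T *m (W *m V))^T i i); last by rewrite mxE.
  by rewrite !trmx_mul trmxK mulmxA.
have := Wc (col i U) (col i V); rewrite !sqn_col_ortho//; lra.
Qed.

End trace_norm.

(** * Frobenius norm and rank *)

Section frobenius_norm.
Variable R : realType.
Implicit Types n : nat.

Lemma cauchy_schwarz n (x y : 'cV[R]_n) : dotv x y ^+ 2 <= sqn x * sqn y.
Proof.
have [->|y0] := eqVneq y 0.
  have -> : dotv x 0 = 0 by rewrite /dotv big1// => i _; rewrite mxE mulr0.
  by rewrite expr0n mulr_ge0 ?sqn_ge0.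
have sy : 0 < sqn y by rewrite lt_def sqn_eq0 y0 sqn_ge0.
have := sqn_ge0 (sqn y *: x + (- dotv x y) *: y).
rewrite sqnD !sqnZ dotvZl dotvZr => h.
have : 0 <= sqn y * (sqn x * sqn y - dotv x y ^+ 2) by lra.
by rewrite pmulr_rge0// subr_ge0.
Qed.

Lemma frob2E m n (A : 'M[R]_(m, n)) : frob2 A = \tr (A^T *m A).
Proof.
rewrite /frob2 exchange_big; apply: eq_bigr => j _.
by rewrite mxE; apply: eq_bigr => i _; rewrite mxE expr2.
Qed.

Lemma frob2_ge0 m n (A : 'M[R]_(m, n)) : 0 <= frob2 A.
Proof. by do 2 (apply: sumr_ge0 => ? _); exact: sqr_ge0. Qed.

Lemma frob2_eq0 m n (A : 'M[R]_(m, n)) : (frob2 A == 0) = (A == 0).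
Proof.
apply/eqP/eqP => [|->]; last first.
  by rewrite /frob2 big1// => i _; rewrite big1// => j _; rewrite mxE expr0n.
move=> /psumr_eq0P A0; apply/matrixP => i j; rewrite mxE.
have /psumr_eq0P /(_ j) : \sum_j A i j ^+ 2 = 0.
  by apply: A0 => // k _; apply: sumr_ge0 => ? _; exact: sqr_ge0.
by move=> /(_ (fun k _ => sqr_ge0 _) isT)/eqP; rewrite sqrf_eq0 => /eqP.
Qed.

Lemma frob2_ortho n (U V A : 'M[R]_n) : U^T *m U = 1%:M -> V^T *m V = 1%:M ->
  frob2 (U *m A *m V^T) = frob2 A.
Proof.
move=> Uo Vo; rewrite !frob2E !trmx_mul trmxK -!mulmxA mxtrace_mulC -!mulmxA Vo mulmx1.
by rewrite [U^T *m _]mulmxA Uo mul1mx.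
Qed.

Lemma frob2_diag n (s : 'rV[R]_n) : frob2 (diag_mx s) = \sum_i s 0 i ^+ 2.
Proof.
apply: eq_bigr => i _; rewrite (bigD1 i)//= big1 ?addr0.
  by rewrite mxE eqxx mulr1n.
by move=> j ji; rewrite mxE eq_sym (negbTE ji) mulr0n expr0n.
Qed.

Lemma frob2D_le m n (A B : 'M[R]_(m, n)) : frob2 (A + B) <= 2 * frob2 A + 2 * frob2 B.
Proof.
rewrite !mulr_sumr -big_split; apply: ler_sum => i _ /=.
rewrite !mulr_sumr -big_split; apply: ler_sum => j _ /=.
by rewrite mxE; have := sqr_ge0 (A i j - B i j); lra.
Qed.

Lemma rank_sum_le m n (I : finType) (P : pred I) (F : I -> 'M[R]_(m, n)) :
  (\rank (\sum_(i | P i) F i)%R <= \sum_(i | P i) \rank (F i))%N.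
Proof.
elim/big_rec2 : _ => [|i A k _ IH]; first by rewrite mxrank0.
by apply: leq_trans (mxrank_add _ _) _; rewrite leq_add2l.
Qed.

Definition nnz n (s : 'rV[R]_n) := #|[pred i | s 0 i != 0]|.

Lemma rank_diag_le n (s : 'rV[R]_n) :
  (\rank (diag_mx s) <= nnz s)%N.
Proof.
rewrite diag_mx_sum_delta (bigID (fun i => s 0 i != 0))/=.
rewrite [X in _ + X]big1 ?addr0; last first.
  by move=> i /negbNE/eqP ->; rewrite scale0r.
apply: leq_trans (rank_sum_le _ _) _; rewrite /nnz -sum1_card leq_sum// => i _.
by apply: leq_trans (mxrank_scale _ _) _; rewrite mxrank_delta.
Qed.

(** The identity is the 0-1 diagonal of the support plus that of its complement; subadditivity of
    rank and [rank_diag_le] on the complement leave at least [nnz s] for the support. *)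
Lemma rank_diag_ge n (s : 'rV[R]_n) :
  (nnz s <= \rank (diag_mx s))%N.
Proof.
pose e : 'rV[R]_n := \row_i (s 0 i != 0)%:R.
pose si : 'rV[R]_n := \row_i (s 0 i)^-1.
have eE : diag_mx e = diag_mx s *m diag_mx si.
  rewrite mulmx_diag; congr diag_mx; apply/rowP => i; rewrite !mxE.
  by have [->|s0] := eqVneq (s 0 i) 0; rewrite ?mul0r// divff.
have : (\rank (diag_mx e) <= \rank (diag_mx s))%N by rewrite eE mxrankM_maxl.
apply: leq_trans.
have : (\rank (1%:M : 'M[R]_n) <= \rank (diag_mx e) + \rank (diag_mx (const_mx 1 - e)%R))%N.
  have -> : 1%:M = diag_mx e + diag_mx (const_mx 1 - e).
    by rewrite -linearD /= addrC subrK diag_const_mx.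
  exact: mxrank_add.
rewrite mxrank1 => h.
have h2 := rank_diag_le (const_mx 1 - e).
have h3 : nnz (const_mx 1 - e) = (n - nnz s)%N.
  have cn : (nnz s + #|[predC [pred i | s 0%R i != 0%R]]| = n)%N.
    by rewrite cardC card_ord.
  rewrite -[X in (X - _)%N]cn addKn; apply: eq_card => i.
  by rewrite !inE !mxE; case: (s 0 i == 0); rewrite /= ?subr0 ?oner_eq0 ?subrr ?eqxx.
have h4 : (nnz s <= n)%N by rewrite -[leqRHS](card_ord n) max_card.
rewrite h3 in h2; move: h h2 h4; set a := \rank _; set b := \rank _; lia.
Qed.

Lemma rank_svd n (U V : 'M[R]_n) (s : 'rV[R]_n) :
  U^T *m U = 1%:M -> V^T *m V = 1%:M ->
  \rank (U *m diag_mx s *m V^T) = nnz s.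
Proof.
move=> Uo Vo; have [_ Uu] := mulmx1_unit Uo; have [Vu _] := mulmx1_unit Vo.
rewrite mxrankMfree ?row_free_unit//.
rewrite -mxrank_tr trmx_mul mxrankMfree ?row_free_unit ?unitmx_tr// mxrank_tr.
by apply/eqP; rewrite eqn_leq rank_diag_le rank_diag_ge.
Qed.

End frobenius_norm.

(** * Deterministic recovery *)

Section svd_blocks.
Variable R : realType.
Implicit Types n : nat.

Lemma ler_sum_seq_const (I : eqType) (s : seq I) (F : I -> R) c :
  (forall i, i \in s -> F i <= c) -> \sum_(i <- s) F i <= (size s)%:R * c.
Proof.
elim: s => [|i s IH] h; first by rewrite big_nil mul0r.
rewrite big_cons /= -natr1 mulrDl mul1r addrC lerD//.
  by apply: IH => j js; apply: h; rewrite in_cons js orbT.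
by apply: h; rewrite mem_head.
Qed.

Lemma ler_const_sum_seq (I : eqType) (s : seq I) (F : I -> R) c :
  (forall i, i \in s -> c <= F i) -> (size s)%:R * c <= \sum_(i <- s) F i.
Proof.
move=> h; rewrite -lerN2 -mulrN -sumrN.
by apply: ler_sum_seq_const => i /h; rewrite lerN2.
Qed.

Section blocks.
Variables (n : nat) (X Y : 'M[R]_n) (t : 'rV[R]_n).
Hypotheses (Xo : X^T *m X = 1%:M) (Yo : Y^T *m Y = 1%:M).
Hypothesis t0 : forall i, 0 <= t 0 i.

(** Indices form a list rather than a set, so that blocks are [take k] and [drop k] of a list sorted
    by singular value. *)
Definition svd_part (l : seq 'I_n) : 'M[R]_n :=
  X *m diag_mx (\row_i (t 0 i * (i \in l)%:R)) *m Y^T.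

Lemma svd_part_cat l1 l2 : uniq (l1 ++ l2) ->
  svd_part (l1 ++ l2) = svd_part l1 + svd_part l2.
Proof.
rewrite cat_uniq => /and3P[_ /hasPn h _].
rewrite -mulmxDl -mulmxDr -linearD /=; congr (_ *m diag_mx _ *m _).
apply/rowP => i; rewrite !mxE -mulrDr mem_cat.
by case: (boolP (i \in l2)) => [/h/negbTE /= ->|_]; rewrite ?orbF ?addr0 ?add0r.
Qed.

Lemma svd_part_rank l : (\rank (svd_part l) <= size l)%N.
Proof.
rewrite /svd_part rank_svd//; apply: leq_trans (card_size l).
apply: subset_leq_card; apply/fintype.subsetP => i; rewrite !inE mxE.
by apply: contraNT => /negbTE ->; rewrite mulr0.
Qed.

Lemma svd_part_frob2 l : uniq l -> frob2 (svd_part l) = \sum_(i <- l) t 0 i ^+ 2.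
Proof.
move=> ul; rewrite frob2_ortho// frob2_diag [RHS]big_uniq//= [RHS]big_mkcond /=.
apply: eq_bigr => i _; rewrite mxE.
by case: (i \in l); rewrite ?mulr1 ?mulr0 ?expr0n.
Qed.

Section tail.
Variable k : nat.
Hypothesis k0 : (0 < k)%N.

Definition decr := sorted (fun i j => t 0 j <= t 0 i).

(** A value beyond position k is at most the mean of the first k values; both tail estimates use
    only this. *)
Lemma le_head_mean l i : decr l -> i \in drop k l ->
  k%:R * t 0 i <= \sum_(j <- take k l) t 0 j.
Proof.
move=> sl il.
have tr : transitive (fun i j => t 0 j <= t 0 i).
  by move=> a b c ab bc; exact: le_trans bc ab.
(* An element of [drop k l] exists, so the head is a full block. *)
have szk : size (take k l) = k.
  rewrite size_take; case: ltnP => // h.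
  by move: il; rewrite drop_oversize.
have tk j : j \in take k l -> t 0 i <= t 0 j.
  move: sl; rewrite /decr sorted_pairwise// -{1}(cat_take_drop k l) pairwise_cat.
  by move=> /and3P[/allrelP h _ _] jl; exact: h.
by rewrite -{1}szk; exact: ler_const_sum_seq.
Qed.

Lemma sum_t_ge0 (l : seq 'I_n) : 0 <= \sum_(i <- l) t 0 i.
Proof. by apply: sumr_ge0. Qed.

(** With head sum S and tail sum T, each tail value satisfies k t_i^2 <= S t_i, and S T <= (S +
    T)^2. *)
Lemma tail_frob2 l : uniq l -> decr l ->
  k%:R * frob2 (svd_part (drop k l)) <= (\sum_(i <- l) t 0 i) ^+ 2.
Proof.
move=> ul dl; rewrite svd_part_frob2 ?drop_uniq// mulr_sumr.
pose S := \sum_(i <- take k l) t 0 i.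
apply: (@le_trans _ _ (S * \sum_(i <- drop k l) t 0 i)).
  rewrite mulr_sumr !big_seq; apply: ler_sum => i il.
  by rewrite expr2 mulrA ler_wpM2r//; exact: le_head_mean.
rewrite -{2}(cat_take_drop k l) big_cat /= -/S.
set T := \sum_(i <- drop k l) _.
have S0 : 0 <= S := sum_t_ge0 _; have T0 : 0 <= T := sum_t_ge0 _.
have := mulr_ge0 S0 T0; have := sqr_ge0 S; have := sqr_ge0 T; lra.
Qed.

(** The Frobenius norm of a block is at most the sum of the preceding block divided by sqrt k, so
    the bounds on f over the blocks add up to at most the whole sum. Induction on the length of the
    list peels one block at a time. *)
Lemma tail_bound (f : 'M[R]_n -> R) c : 0 <= c ->
    (forall A B, f (A + B) <= f A + f B) ->
    (forall A, (\rank A <= k)%N -> f A <= c * Num.sqrt (frob2 A)) ->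
  forall l, uniq l -> decr l ->
    Num.sqrt k%:R * f (svd_part (drop k l)) <= c * \sum_(i <- l) t 0 i.
Proof.
move=> c0 fD fk l; have [m] := ubnP (size l); elim: m => // m IH in l *.
move=> lm ul dl; have [lk|kl] := leqP (size l) k.
  rewrite drop_oversize//.
  (* Subadditivity only gives f 0 >= 0; the upper bound on matrices of rank 0 gives the other
     direction. *)
  have f0 : f (svd_part [::]) <= 0.
    apply: le_trans (fk _ _) _; first by apply: leq_trans (svd_part_rank _) _.
    by rewrite svd_part_frob2// big_nil sqrtr0 mulr0.
  apply: (@le_trans _ _ 0); last by rewrite mulr_ge0// sum_t_ge0.
  by rewrite mulr_ge0_le0// sqrtr_ge0.
set l' := drop k l.
have ul' : uniq l' by exact: drop_uniq.
have dl' : decr l' by exact: drop_sorted.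
have IHl : Num.sqrt k%:R * f (svd_part (drop k l')) <= c * \sum_(i <- l') t 0 i.
  apply: IH => //; rewrite size_drop; move: lm kl k0; set a := size l; lia.
pose S := \sum_(i <- take k l) t 0 i.
have S0 : 0 <= S := sum_t_ge0 _.
have fS : Num.sqrt k%:R * f (svd_part (take k l')) <= c * S.
  apply: (@le_trans _ _ (Num.sqrt k%:R * (c * Num.sqrt (frob2 (svd_part (take k l')))))).
    rewrite ler_wpM2l ?sqrtr_ge0//; apply: fk.
    by apply: leq_trans (svd_part_rank _) _; rewrite size_take_min geq_minl.
  rewrite mulrCA ler_wpM2l// -sqrtrM ?ler0n//.
  rewrite -(ger0_norm S0) -sqrtr_sqr ler_wsqrtr// svd_part_frob2 ?take_uniq//.
  have hS j : j \in take k l' -> k%:R * t 0 j <= S.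
    by move=> /mem_take; exact: le_head_mean.
  apply: (@le_trans _ _ (S * \sum_(i <- take k l') t 0 i)).
    rewrite !mulr_sumr !big_seq; apply: ler_sum => i il.
    by rewrite expr2 mulrA ler_wpM2r//; exact: hS.
  rewrite expr2 ler_wpM2l// -(ler_pM2l (_ : 0 < k%:R)) ?ltr0n//.
  rewrite mulr_sumr; apply: le_trans (ler_sum_seq_const hS) _.
  by rewrite ler_wpM2r// ler_nat size_take_min geq_minl.
have -> : svd_part l' = svd_part (take k l') + svd_part (drop k l').
  by rewrite -svd_part_cat cat_take_drop.
apply: (@le_trans _ _ (Num.sqrt k%:R * (f (svd_part (take k l')) + f (svd_part (drop k l'))))).
  by rewrite ler_wpM2l ?sqrtr_ge0.
rewrite mulrDr -[X in c * \sum_(i <- X) _](cat_take_drop k l) big_cat /= mulrDr.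
by rewrite lerD.
Qed.

End tail.
End blocks.
End svd_blocks.

(** * The cone condition, and recovery from two-sided bounds on low-rank matrices *)

Section low_rank_recovery.
Variable R : realType.
Implicit Types n : nat.

Lemma sqr_trace_diag_le n (e : 'rV[R]_n) (A : 'M[R]_n) :
  (forall i, e 0 i = 0 \/ e 0 i = 1) ->
  \tr (diag_mx e *m A) ^+ 2 <= (nnz e)%:R * frob2 A.
Proof.
move=> e01; rewrite mxtrace_diag_mul.
have := cauchy_schwarz e^T (\col_i A i i).
have -> : dotv e^T (\col_i A i i) = \sum_i e 0 i * A i i.
  by apply: eq_bigr => i _; rewrite !mxE.
move=> h; apply: le_trans h _.
have -> : sqn e^T = (nnz e)%:R.
  rewrite /nnz -sum1_card natr_sum [RHS]big_mkcond /=; apply: eq_bigr => i _.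
  by rewrite mxE inE; case: (e01 i) => ->; rewrite ?expr0n ?eqxx ?expr1n ?oner_eq0.
rewrite ler_wpM2l// /sqn; apply: ler_sum => i _; rewrite mxE (bigD1 i)//= lerDl.
by apply: sumr_ge0 => j _; exact: sqr_ge0.
Qed.

(** In the singular bases of H, let E project onto the support of s and F = 1 - E. The part E Zt + F
    Zt E of Zt has rank at most 2 rank H, and F Zt F has singular values t. Pairing H + Z with a
    subgradient gives sum t <= - tr (E Zt), and Cauchy-Schwarz on the diagonal bounds the right side
    by sqrt (rank H) |Z|_F. *)
Lemma cone_bound n (H Z : 'M[R]_n) : trace_norm (H + Z) <= trace_norm H ->
  exists (U V Z1 X Y : 'M[R]_n) (t : 'rV[R]_n),
  [/\ U^T *m U = 1%:M, V^T *m V = 1%:M, X^T *m X = 1%:M & Y^T *m Y = 1%:M] /\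
  [/\ forall i, 0 <= t 0 i, (\rank Z1 <= 2 * \rank H)%N,
    U^T *m Z *m V = Z1 + X *m diag_mx t *m Y^T &
    (\sum_i t 0 i) ^+ 2 <= (\rank H)%:R * frob2 Z].
Proof.
move=> HZ; have [U [V [s [Uo Vo s0 HE]]]] := svd H.
pose Zt := U^T *m Z *m V.
pose e : 'rV[R]_n := \row_i (s 0 i != 0)%:R.
pose E := diag_mx e; pose F := 1%:M - E.
have EE : E *m E = E.
  rewrite mulmx_diag; congr diag_mx; apply/rowP => i; rewrite !mxE -natrM mulnb.
  by rewrite andbb.
have ET : E^T = E by rewrite tr_diag_mx.
have EF : E *m F = 0 by rewrite mulmxBr mulmx1 EE subrr.
have FE : F *m E = 0 by rewrite mulmxBl mul1mx EE subrr.
have FF : F *m F = F by rewrite {1}/F mulmxBl mul1mx EF subr0.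
have FT : F^T = F by rewrite linearB /= trmx1 ET.
have [X [Y [t [Xo Yo t0 ZE]]]] := svd (F *m Zt *m F).
(* The polar factor X Y^T need not live on the range of F when t has zeros, so [G] keeps only the
   support of t. There [ti] inverts t, which exhibits [G] as a multiple of F Zt F on either side. *)
pose p : 'rV[R]_n := \row_i (t 0 i != 0)%:R.
pose ti : 'rV[R]_n := \row_i (t 0 i)^-1.
pose G := X *m diag_mx p *m Y^T.
have pE : diag_mx p = diag_mx t *m diag_mx ti.
  rewrite mulmx_diag; congr diag_mx; apply/rowP => i; rewrite !mxE.
  by have [->|ti0] := eqVneq (t 0 i) 0; rewrite ?mul0r// divff.
have FG : F *m G = G.
  have -> : G = (F *m Zt *m F) *m (Y *m diag_mx ti *m Y^T).
    by rewrite ZE /G pE !mulmxA -(mulmxA _ Y^T) Yo mulmx1.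
  by rewrite !mulmxA FF.
have GF : G *m F = G.
  have -> : G = (X *m diag_mx ti *m X^T) *m (F *m Zt *m F).
    by rewrite ZE /G pE diag_mxC !mulmxA -(mulmxA _ X^T) Xo mulmx1.
  by rewrite -!mulmxA FF.
have GE : G = X *m diag_mx p *m Y^T by [].
clearbody G.
(* W0 is a subgradient of the trace norm at H, aligned with the part of Z
   orthogonal to the row and column spaces of H. *)
pose W := E + G; pose W0 := U *m W *m V^T.
have sqEF x : sqn x = sqn (E *m x) + sqn (F *m x).
  rewrite !sqnE !dotvMl ET FT !mulmxA EE FF -dotvDr -mulmxDl.
  by rewrite addrC subrK mul1mx.
(* E and G act on orthogonal blocks, so the inequality splits into one for E and one for G. *)
have Wc : contraction W.
  move=> x y; rewrite (sqEF x) (sqEF y) mulmxDl dotvDr.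
  have -> : dotv x (E *m y) = dotv (E *m x) (E *m y).
    by rewrite dotvMl ET mulmxA EE.
  have -> : dotv x (G *m y) = dotv (F *m x) (G *m (F *m y)).
    by rewrite dotvMl FT !mulmxA FG GF.
  move: (E *m x) (E *m y) (F *m x) (F *m y) => a b c d.
  have h1 : 2 * dotv a b <= sqn a + sqn b.
    have := @contraction_ortho R n 1%:M _ a b; rewrite trmx1 !mul1mx; exact.
  suff h2 : 2 * dotv c (G *m d) <= sqn c + sqn d by lra.
  have dE (w : 'cV[R]_n) i : (diag_mx p *m w) i 0 = (t 0 i != 0)%:R * w i 0.
    by rewrite mul_diag_mx !mxE.
  rewrite GE -mulmxA -mulmxA dotvC dotvMl dotvC.
  rewrite -(sqn_ortho c (orthoT Xo)) -(sqn_ortho d (orthoT Yo)).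
  rewrite /dotv mulr_sumr -big_split; apply: ler_sum => i _ /=.
  rewrite dE; set u := (X^T *m c) i 0; set v := (Y^T *m d) i 0.
  case: (t 0 i != 0) => /=; rewrite ?mul0r ?mulr0 ?mul1r.
    by have := sqr_ge0 (u - v); lra.
  by have := sqr_ge0 u; have := sqr_ge0 v; lra.
have W0c : contraction W0.
  move=> x y; rewrite /W0 -!mulmxA dotvC dotvMl dotvC.
  by rewrite -(sqn_ortho x (orthoT Uo)) -(sqn_ortho y (orthoT Vo)).
have := trace_norm_dual (H + Z) W0c.
have -> : \tr (W0^T *m (H + Z)) = \sum_i s 0 i + \tr (E *m Zt) + \sum_i t 0 i.
  have -> : \tr (W0^T *m (H + Z)) = \tr (W^T *m (diag_mx s + Zt)).
    rewrite /W0 !trmx_mul trmxK -!mulmxA mxtrace_mulC -!mulmxA HE.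
    congr (\tr (_ *m _)); rewrite mulmxDl mulmxDr /Zt !mulmxA Uo mul1mx.
    by rewrite -mulmxA Vo mulmx1.
  rewrite mulmxDr mxtraceD -addrA; congr (_ + _).
    have Es : E *m diag_mx s = diag_mx s.
      rewrite mulmx_diag; congr diag_mx; apply/rowP => i; rewrite !mxE.
      by have [->|ti0] := eqVneq (s 0 i) 0; rewrite ?mulr0// mul1r.
    rewrite -Es mulmxA /W linearD /= mulmxDl ET EE.
    by rewrite -{1}FG trmx_mul FT -mulmxA FE mulmx0 addr0 Es mxtrace_diag.
  rewrite /W linearD /= mulmxDl mxtraceD ET; congr (_ + _).
  have -> : \tr (G^T *m Zt) = \tr (G^T *m (F *m Zt *m F)).
    by rewrite -{1}GF -{1}FG !trmx_mul FT -!mulmxA mxtrace_mulC !mulmxA.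
  rewrite ZE GE !trmx_mul trmxK tr_diag_mx -!mulmxA mxtrace_mulC -!mulmxA Yo mulmx1.
  rewrite [X^T *m _]mulmxA Xo mul1mx mxtrace_diag_mul; apply: eq_bigr => i _.
  by rewrite !mxE eqxx mulr1n; have [->|_] := eqVneq (t 0 i) 0; rewrite ?mul0r ?mul1r.
move=> h; have {}h := le_trans h HZ.
rewrite {}HE in HZ h *; rewrite trace_norm_svd// in h.
rewrite rank_svd//.
have ne : nnz e = nnz s.
  by apply: eq_card => i; rewrite !inE mxE; case: (s 0 i == 0); rewrite ?eqxx ?oner_eq0.
exists U, V, (Zt - F *m Zt *m F), X, Y, t; split; first by split.
split => //.
- have -> : Zt - F *m Zt *m F = E *m Zt + F *m Zt *m E.
    have -> : F *m Zt = Zt - E *m Zt by rewrite mulmxBl mul1mx.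
    rewrite [in LHS]mulmxBr mulmx1; set A := E *m Zt.
    move: (_ *m E) => B.
    by rewrite opprB addrCA opprB (addrCA Zt) subrr addr0 addrC.
  apply: leq_trans (mxrank_add _ _) _; rewrite mul2n -addnn -ne leq_add//.
    by apply: leq_trans (mxrankM_maxl _ _) _; exact: rank_diag_le.
  by apply: leq_trans (mxrankM_maxr _ _) _; exact: rank_diag_le.
- by rewrite -ZE subrK.
have frZ : frob2 Zt = frob2 Z.
  by rewrite /Zt -[V]trmxK frob2_ortho//; exact: orthoT.
rewrite -ne -frZ; apply: le_trans (sqr_trace_diag_le _ _); last first.
  by move=> i; rewrite mxE; case: eqP; [left|right].
have T0 : 0 <= \sum_i t 0 i by exact: sumr_ge0.
rewrite -[leRHS]sqrrN ler_pXn2r ?nnegrE//; rewrite -/E; lra.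
Qed.

(** With r = rank H, the head consists of the rank 2 r part and the K r largest remaining singular
    values, whence the rank (K + 2) r. As f Z = 0, f is no larger on the head than on the tail, so
    c1 |head|_F <= c2 |Z|_F / sqrt K; also |tail|_F <= |Z|_F / sqrt K. Then |Z|_F^2 <= 2 |head|_F^2
    + 2 |tail|_F^2 contradicts the choice of K. *)
Lemma deterministic_recovery n (H Z : 'M[R]_n) (f : 'M[R]_n -> R) (c1 c2 : R) (K : nat) :
  (0 < K)%N -> 0 < c1 -> 0 <= c2 -> 2 * (1 + (c2 / c1) ^+ 2) < K%:R ->
  H != 0 ->
  (forall A B, f (A + B) <= f A + f B) -> (forall A, f (- A) = f A) ->
  (forall A, (\rank A <= (K + 2) * \rank H)%N ->
    c1 * Num.sqrt (frob2 A) <= f A <= c2 * Num.sqrt (frob2 A)) ->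
  f Z = 0 -> Z != 0 -> trace_norm H < trace_norm (H + Z).
Proof.
move=> K0 c10 c20 Kc H0 fD fN fk fZ Z0; rewrite ltNge; apply/negP => HZ.
have [U [V [Z1 [X [Y [t [[Uo Vo Xo Yo] [t0 rZ1 ZE tau]]]]]]]] := cone_bound HZ.
set r := \rank H in fk rZ1 tau.
have r0 : (0 < r)%N by rewrite lt0n mxrank_eq0.
pose k := (K * r)%N; have k0 : (0 < k)%N by rewrite muln_gt0 K0.
pose Zt := U^T *m Z *m V.
pose g (A : 'M[R]_n) := f (U *m A *m V^T).
have gD A B : g (A + B) <= g A + g B by rewrite /g mulmxDr mulmxDl.
have gk A : (\rank A <= (K + 2) * r)%N ->
    c1 * Num.sqrt (frob2 A) <= g A <= c2 * Num.sqrt (frob2 A).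
  move=> rA; rewrite -(frob2_ortho _ Uo Vo); apply: fk; apply: leq_trans rA.
  by apply: leq_trans (mxrankM_maxl _ _) _; exact: mxrankM_maxr.
have gZ : g Zt = 0.
  by rewrite /g /Zt !mulmxA (orthoC Uo) mul1mx -mulmxA (orthoC Vo) mulmx1.
pose l := sort (fun i j => t 0 j <= t 0 i) (enum 'I_n).
have ul : uniq l by rewrite sort_uniq enum_uniq.
have dl : decr t l by apply: sort_sorted => i j; exact: le_total.
have lE : svd_part X Y t l = X *m diag_mx t *m Y^T.
  congr (_ *m diag_mx _ *m _); apply/rowP => i.
  by rewrite mxE mem_sort mem_enum mulr1.
have sumE : \sum_(i <- l) t 0 i = \sum_i t 0 i.
  by rewrite (perm_big _ (permEl (perm_sort _ _))) big_enum.
set T := \sum_i t 0 i in tau sumE.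
have T0 : 0 <= T by exact: sumr_ge0.
pose tl := svd_part X Y t (drop k l); pose hd := Z1 + svd_part X Y t (take k l).
have ZtE : Zt = hd + tl.
  by rewrite /Zt ZE -lE -addrA -svd_part_cat ?cat_take_drop.
have rhd : (\rank hd <= (K + 2) * r)%N.
  apply: leq_trans (mxrank_add _ _) _; rewrite mulnDl addnC leq_add//.
  by apply: leq_trans (svd_part_rank _ Xo Yo _) _; rewrite size_take_min geq_minl.
have gtl : Num.sqrt k%:R * g tl <= c2 * T.
  rewrite -sumE; apply: tail_bound => // A rA; have /gk/andP[]// : (\rank A <= (K + 2) * r)%N.
  by apply: leq_trans rA _; rewrite mulnDl leq_addr.
have gtN : g (- tl) = g tl by rewrite /g mulmxN mulNmx fN.
have ghd : g hd <= g tl.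
  have -> : hd = Zt + - tl by rewrite ZtE addrK.
  by apply: le_trans (gD _ _) _; rewrite gZ add0r gtN.
have Ntl : k%:R * frob2 tl <= T ^+ 2 by rewrite -sumE; exact: tail_frob2.
have sk : 0 < Num.sqrt k%:R :> R by rewrite sqrtr_gt0 ltr0n.
have Nhd : k%:R * (c1 ^+ 2 * frob2 hd) <= c2 ^+ 2 * T ^+ 2.
  have h : Num.sqrt k%:R * (c1 * Num.sqrt (frob2 hd)) <= c2 * T.
    apply: le_trans gtl; rewrite ler_pM2l//; apply: le_trans ghd.
    by case/andP: (gk _ rhd).
  rewrite -exprMn -(sqr_sqrtr (frob2_ge0 hd)) -[in leLHS](@sqr_sqrtr _ k%:R)//.
  rewrite -!exprMn ler_pXn2r// nnegrE ?mulr_ge0 ?sqrtr_ge0// ltW//.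
have frZ : frob2 Zt = frob2 Z.
  by rewrite /Zt -[V]trmxK frob2_ortho//; exact: orthoT.
have NZ : 0 < frob2 Z by rewrite lt_def frob2_eq0 Z0 frob2_ge0.
have NZ2 := frob2D_le hd tl; rewrite -ZtE frZ in NZ2.
have rR : 0 < r%:R :> R by rewrite ltr0n.
have {}Nhd : K%:R * c1 ^+ 2 * frob2 hd <= c2 ^+ 2 * frob2 Z.
  rewrite -(ler_pM2l rR); apply: le_trans (_ : c2 ^+ 2 * T ^+ 2 <= _); last first.
    by rewrite [leRHS]mulrCA ler_wpM2l ?sqr_ge0.
  by apply: le_trans Nhd; rewrite /k natrM le_eqVlt; apply/orP; left; apply/eqP; ring.
have {}Ntl : K%:R * frob2 tl <= frob2 Z.
  rewrite -(ler_pM2l rR); apply: le_trans tau; apply: le_trans Ntl.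
  by rewrite /k natrM mulrCA !mulrA.
have c12 : 0 < c1 ^+ 2 by rewrite exprn_gt0.
have : K%:R * c1 ^+ 2 * frob2 Z <= 2 * (1 + (c2 / c1) ^+ 2) * c1 ^+ 2 * frob2 Z.
  have -> : 2 * (1 + (c2 / c1) ^+ 2) * c1 ^+ 2 = 2 * c1 ^+ 2 + 2 * c2 ^+ 2.
    by field; rewrite gt_eqF.
  have h1 : K%:R * c1 ^+ 2 * frob2 Z <=
      K%:R * c1 ^+ 2 * (2 * frob2 hd + 2 * frob2 tl).
    by rewrite ler_wpM2l// mulr_ge0// ltW.
  have h2 := ler_wpM2l (ltW c12) Ntl.
  lra.
by rewrite leNgt !ltr_pM2r// Kc.
Qed.

End low_rank_recovery.

(** * Independent pairs *)

Section density.
Context d (T : measurableType d) (R : realType) (mu : {measure set T -> \bar R}).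
Variable h : T -> R.
Hypotheses (h0 : forall x, 0 <= h x) (mh : measurable_fun setT h).
Local Open Scope ereal_scope.

(* [h0] and [mh] occur as arguments so that the measure instance can be inferred
   from the application; the same goes for [mZ] in [law_of]. *)
Definition mdens (h0 : forall x, (0 <= h x)%R) (mh : measurable_fun setT h)
  (A : set T) : \bar R := \int[mu]_(x in A) (h x)%:E.

Let mdens0 : mdens h0 mh set0 = 0.
Proof. by rewrite /mdens integral_set0. Qed.

Let mdens_ge0 A : 0 <= mdens h0 mh A.
Proof. by apply: integral_ge0 => x _; rewrite lee_fin. Qed.

Let mhE : measurable_fun setT (EFin \o h).
Proof. exact/measurable_EFinP. Qed.

Let mdens_sigma_additive : semi_sigma_additive (mdens h0 mh).
Proof.
move=> /= A mA tA mUA; rewrite /mdens ge0_integral_bigcup//=.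
- apply: is_cvg_ereal_nneg_natsum_cond => n _ _.
  by apply: integral_ge0 => x _; rewrite lee_fin.
- exact: measurable_funTS.
- by move=> x _; rewrite lee_fin.
Qed.

HB.instance Definition _ := isMeasure.Build _ _ _
  (mdens h0 mh) mdens0 mdens_ge0 mdens_sigma_additive.

Import HBNNSimple.

(** Monotone convergence along simple approximations reduces f to indicators, where the identity is
    the definition of [mdens]. *)
Lemma ge0_integral_mdens (f : T -> \bar R) : (forall x, 0 <= f x) ->
    measurable_fun setT f ->
  \int[mdens h0 mh]_x f x = \int[mu]_x (f x * (h x)%:E).
Proof.
move=> f0 mf; pose s := nnsfun_approx measurableT mf.
have -> : \int[mdens h0 mh]_x f x =
    lim (\int[mdens h0 mh]_x (EFin \o s n) x @[n --> \oo]).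
  have fE x : f x = lim ((EFin \o s n) x @[n --> \oo]).
    by apply/esym/cvg_lim => //; exact: cvg_nnsfun_approx.
  under eq_integral do rewrite fE.
  apply: monotone_convergence => //.
  - by move=> n; exact/measurable_EFinP.
  - by move=> n x _ /=; rewrite lee_fin.
  - by move=> x _ a b ab; rewrite lee_fin; exact/lefP/nd_nnsfun_approx.
have -> : \int[mu]_x (f x * (h x)%:E) =
    lim (\int[mu]_x ((EFin \o s n) x * (h x)%:E) @[n --> \oo]).
  have fE x : f x * (h x)%:E = lim ((EFin \o s n) x * (h x)%:E @[n --> \oo]).
    by apply/esym/cvg_lim => //; apply: cvgeZr => //; exact: cvg_nnsfun_approx.
  under eq_integral do rewrite fE.
  apply: monotone_convergence => //.
  - by move=> n; apply: emeasurable_funM => //; exact/measurable_EFinP.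
  - by move=> n x _ /=; rewrite mule_ge0// lee_fin.
  - move=> x _ a b ab; rewrite lee_wpmul2r ?lee_fin//.
    exact/lefP/nd_nnsfun_approx.
suff suf n : \int[mdens h0 mh]_x (EFin \o s n) x =
    \int[mu]_x ((EFin \o s n) x * (h x)%:E).
  by under eq_fun do rewrite suf.
transitivity (\int[mdens h0 mh]_x
   (\sum_(y \in range (s n)) (y * \1_(s n @^-1` [set y]) x)%:E)).
  by apply: eq_integral => t tE; rewrite /= fimfunE -fsumEFin.
rewrite ge0_integral_fsum//; last 2 first.
- by move=> r; exact/measurable_EFinP/measurable_funM.
- by move=> m y Ey; exact: nnfun_muleindic_ge0.
transitivity (\int[mu]_x (\sum_(y \in range (s n))
    (y * \1_(s n @^-1` [set y]) x)%:E * (h x)%:E)); last first.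
  apply: eq_integral => x _ /=; rewrite -ge0_mule_fsuml => [|y]; last first.
    exact: nnfun_muleindic_ge0.
  by rewrite fsumEFin// -(fimfunE _ x).
rewrite ge0_integral_fsum//; last 2 first.
- move=> y; apply: emeasurable_funM => //.
  exact/measurable_EFinP/measurable_funM.
- by move=> m y Ey; apply: mule_ge0; [exact: nnfun_muleindic_ge0|rewrite lee_fin].
apply: eq_fsbigr => r rhn.
rewrite integralZl_indic_nnsfun//.
under [RHS]eq_integral do rewrite EFinM -muleA.
rewrite ge0_integralZl//.
- rewrite integral_indic// setIT; congr (_ * _); rewrite /= /mdens.
  rewrite integral_mkcond; apply: eq_integral => x _.
  by rewrite patchE indicE; case: ifPn => _; rewrite ?mul1e ?mul0e.
- by apply: emeasurable_funM => //; exact/measurable_EFinP.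
- by move=> t Et; rewrite mule_ge0 ?lee_fin.
- by move: rhn; rewrite inE => -[t _ <-]; rewrite lee_fin.
Qed.

End density.

Section weighted_law.
Context d d' (T : measurableType d) (T' : measurableType d') (R : realType).
Context (mu : {measure set T -> \bar R}) (Z : T -> T').
Local Open Scope ereal_scope.

Definition law_of (mZ : measurable_fun setT Z) (A : set T') : \bar R :=
  mu (Z @^-1` A).

Hypothesis mZ : measurable_fun setT Z.

Let law0 : law_of mZ set0 = 0. Proof. exact: measure0. Qed.
Let law_ge0 A : 0 <= law_of mZ A. Proof. exact: measure_ge0. Qed.
Let law_sigma_additive : semi_sigma_additive (law_of mZ).
Proof.
move=> F mF tF mUF; rewrite /law_of preimage_bigcup.
apply: measure_semi_sigma_additive.
- by move=> n; rewrite -[X in measurable X]setTI; exact: mZ.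
- apply/trivIsetP => /= i j _ _ ij; rewrite -preimage_setI.
  by move/trivIsetP : tF => /(_ _ _ _ _ ij) ->//; rewrite preimage_set0.
- by rewrite -preimage_bigcup -[X in measurable X]setTI; exact: mZ.
Qed.
HB.instance Definition _ := isMeasure.Build _ _ _
  (law_of mZ) law0 law_ge0 law_sigma_additive.

Lemma ge0_integral_law (f : T' -> \bar R) : (forall x, 0 <= f x) ->
  measurable_fun setT f -> \int[law_of mZ]_x f x = \int[mu]_x f (Z x).
Proof.
move=> f0 mf; rewrite -(preimage_setT Z) -ge0_integral_pushforward//.
Qed.

End weighted_law.

Section product_rectangles.
Context d1 d2 (T1 : measurableType d1) (T2 : measurableType d2) (R : realType).
Local Open Scope ereal_scope.

Lemma eq_measure_rectangles (m1 m2 : {measure set (T1 * T2) -> \bar R}) :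
  m1 setT < +oo ->
  (forall A B, measurable A -> measurable B -> m1 (A `*` B) = m2 (A `*` B)) ->
  forall C, measurable C -> m1 C = m2 C.
Proof.
move=> moo m12 C mC.
pose G := [set A `*` B | A in @measurable _ T1 & B in @measurable _ T2].
apply: (@g_sigma_algebra_measure_unique _ _ _ G _ (fun=> setT)).
- by move=> _ [A mA [B mB <-]]; exact: measurableX.
- by move=> _; exists setT => //; exists setT => //; rewrite setXTT.
- by rewrite bigcup_const//; exists 0%N.
- move=> _ _ [A mA [B mB <-]] [A' mA' [B' mB' <-]].
  rewrite -setXI; exists (A `&` A'); first exact: measurableI.
  by exists (B `&` B') => //; exact: measurableI.
- by move=> _ [A mA [B mB <-]]; exact: m12.
- by [].
- by rewrite -measurable_prod_measurableType.
Qed.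

End product_rectangles.

(** * Expectation of a product over independent pairs *)

Section independent_pairs.
Context d d' (Omega : measurableType d) (T : measurableType d') (R : realType).
Context (P : probability Omega R) (M : nat) (u v : 'I_M -> {RV P >-> T}).
Hypothesis ind : mutually_independent (joint_family u v).
Local Open Scope ereal_scope.

Let I i (g : T * T -> R) :=
  \int[distribution P (u i) \x distribution P (v i)]_z (g z)%:E.
Let Z i w := (u i w, v i w).

Let mZ i : measurable_fun setT (Z i).
Proof. by apply: measurable_fun_pair. Qed.

Let Ige0 i g : (forall z, 0 <= g z)%R -> 0 <= I i g.
Proof. by move=> g0; apply: integral_ge0 => z _; rewrite lee_fin. Qed.

Let I_rect i A B : measurable A -> measurable B ->
  I i \1_(A `*` B) = P (u i @^-1` A) * P (v i @^-1` B).
Proof.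
move=> mA mB; rewrite /I integral_indic//; last exact: measurableX.
rewrite setIT; exact: product_measure1E.
Qed.

Let rect (g : T * T -> R) :=
  exists A B, [/\ measurable A, measurable B & g = \1_(A `*` B)].

(** A product of rectangle indicators is the indicator of one intersection over ['I_M + 'I_M], which
    is the form of the independence hypothesis. *)
Let indep_rect (g : 'I_M -> T * T -> R) : (forall i, rect (g i)) ->
  \int[P]_w (\prod_i g i (Z i w))%:E = \prod_i I i (g i).
Proof.
move=> /choice[A /choice[B gAB]].
pose C (k : 'I_M + 'I_M) := match k with inl i => A i | inr i => B i end.
have mC k : measurable (C k) by case: k => i /=; case: (gAB i).
have := ind [set: 'I_M + 'I_M]%SET mC.
set E := \bigcap_(i in _) _ => PE.
have -> : \prod_i I i (g i) = \prod_i (P (u i @^-1` A i) * P (v i @^-1` B i)).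
  by apply: eq_bigr => i _; case: (gAB i) => mA mB ->; exact: I_rect.
rewrite big_split /=.
have -> : \prod_i P (u i @^-1` A i) * \prod_i P (v i @^-1` B i) = P E.
  by rewrite PE big_sumType /=; congr (_ * _); apply: eq_bigl => i; rewrite inE.
have mE : measurable E.
  apply: fin_bigcap_measurable => // k _; rewrite -[X in measurable X]setTI.
  exact: measurable_funPT.
have -> : P E = \int[P]_w (\1_E w)%:E by rewrite integral_indic// setIT.
apply: eq_integral => w _; congr EFin.
rewrite indicE; case: (pselect (E w)) => [Ew|nEw].
  rewrite mem_set//= big1// => i _; case: (gAB i) => _ _ ->.
  rewrite indicE mem_set//; split => /=.
    by apply: (Ew (inl i)); rewrite /= inE.
  by apply: (Ew (inr i)); rewrite /= inE.
rewrite memNset//=; move/existsNP : nEw => [k /not_implyP[_ nk]].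
pose i := match k with inl i => i | inr i => i end.
rewrite (bigD1 i)//=; case: (gAB i) => _ _ ->; rewrite indicE memNset ?mul0r//.
by move=> [h1 h2]; apply: nk; rewrite /i in h1 h2 *; case: (k) h1 h2.
Qed.

(* Replaces the indicators of rectangles by general functions one index at a time. *)
Let indep_step k (g : 'I_M -> T * T -> R) :
  (forall i z, 0 <= g i z)%R -> (forall i, measurable_fun setT (g i)) ->
  (forall i, I i (g i) < +oo) -> (forall i : 'I_M, (k <= i)%N -> rect (g i)) ->
  \int[P]_w (\prod_i g i (Z i w))%:E = \prod_i I i (g i).
Proof.
elim: k g => [|k IH] g g0 mg gfin grect; first by apply: indep_rect => i; exact: grect.
have [kM|Mk] := ltnP k M; last first.
  apply: IH => // i ki; have := ltn_ord i.
  by rewrite ltnNge (leq_trans Mk).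
pose i0 := Ordinal kM.
pose h w := (\prod_(i | i != i0) g i (Z i w))%R.
have h0 w : (0 <= h w)%R by apply: prodr_ge0.
have mh : measurable_fun setT h.
  rewrite (_ : h = fun w => (\prod_i (if i != i0 then g i (Z i w) else 1))%R); last first.
    by apply/funext => w; rewrite /h big_mkcond.
  apply: measurable_prod => i _; case: (i != i0); last exact: measurable_cst.
  exact: measurableT_comp (mg i) (mZ i).
pose c := \prod_(i | i != i0) I i (g i).
have c0 : 0 <= c by apply: prode_ge0 => i _; exact: Ige0.
have cfin : c \is a fin_num.
  rewrite /c; elim/big_ind : _ => // [x y|i _]; first exact: fin_numM.
  by rewrite ge0_fin_numE ?gfin// Ige0.
have fc0 : (0 <= fine c)%R by exact: fine_ge0.
(* [m1] is the law of the pair i0 under P weighted by the other factors, [m2] the product law times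
   the integrals of the other factors. On rectangles they agree by the induction hypothesis, hence
   everywhere, and integrating g i0 against both finishes the step. *)
pose m1 : {measure set (T * T) -> \bar R} := law_of (mdens P h0 mh) (mZ i0).
pose m2 : {measure set (T * T) -> \bar R} :=
  mscale (NngNum fc0) (distribution P (u i0) \x distribution P (v i0)).
have m12 : forall C, measurable C -> m1 C = m2 C.
  have key A B : measurable A -> measurable B -> m1 (A `*` B) = m2 (A `*` B).
    move=> mA mB.
    pose g' i := if i == i0 then \1_(A `*` B) else g i.
    have I' : I i0 (g' i0) = P (u i0 @^-1` A) * P (v i0 @^-1` B).
      by rewrite /g' eqxx I_rect.
    have g'E : forall i, i != i0 -> g' i = g i by move=> i; rewrite /g' => /negbTE ->.
    have mAB : measurable (A `*` B) by exact: measurableX.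
    have := IH g'; rewrite [X in _ -> _ -> _ -> _ -> _ = X](bigD1 i0)//= I'.
    rewrite (eq_bigr (fun i => I i (g i))); last by move=> i ii; rewrite g'E.
    rewrite -/c => IHg.
    rewrite /m2 /= /mscale /= fineK// product_measure1E// muleC -IHg.
    - rewrite /m1 /= /law_of /mdens integral_mkcond; apply: eq_integral => w _.
      rewrite (bigD1 i0)//= (eq_bigr (fun i => g i (Z i w))); last first.
        by move=> i ii; rewrite g'E.
      rewrite -/(h w) patchE /g' eqxx indicE -[w \in _]/(Z i0 w \in A `*` B).
      by case: ifPn => _; rewrite ?mul1r ?mul0r.
    - by move=> i z; rewrite /g'; case: ifP.
    - by move=> i; rewrite /g'; case: ifP => // _; exact: measurable_indic.
    - move=> i; have [->|ii] := eqVneq i i0; last by rewrite g'E.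
      by rewrite I' -ge0_fin_numE ?mule_ge0// fin_numM ?fin_num_measure// -[X in measurable X]setTI; exact: measurable_funPT.
    - move=> i ki; rewrite /g'; case: eqVneq => [_|ii]; first by exists A, B.
      by apply: grect; rewrite ltn_neqAle ki andbT eq_sym.
  apply: eq_measure_rectangles => //.
  have m1T : (distribution P (u i0) \x distribution P (v i0)) setT = 1.
    exact: probability_setT.
  by rewrite -setXTT key// setXTT /m2 /= /mscale /= m1T mule1 ltry.
have gE w : (\prod_i g i (Z i w))%:E = (g i0 (Z i0 w))%:E * (h w)%:E.
  by rewrite (bigD1 i0)//= EFinM.
under eq_integral do rewrite gE.
have mgE : measurable_fun setT (EFin \o g i0) by exact/measurable_EFinP.
rewrite -(@ge0_integral_mdens _ _ _ P h h0 mh (fun w => (g i0 (Z i0 w))%:E)); last 2 first.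
- by move=> w; rewrite lee_fin.
- exact: measurableT_comp mgE (mZ i0).
rewrite -(@ge0_integral_law _ _ _ _ _ (mdens P h0 mh) _ (mZ i0) (EFin \o g i0))//; last first.
  by move=> z; rewrite lee_fin.
rewrite (eq_measure_integral m2); last by move=> C mC _; exact: m12.
rewrite ge0_integral_mscale//; last by move=> z _; rewrite /= lee_fin.
by rewrite /= fineK// muleC [RHS](bigD1 i0).
Qed.

Lemma indep_prod (g : 'I_M -> T * T -> R) :
  (forall i z, 0 <= g i z)%R -> (forall i, measurable_fun setT (g i)) ->
  (forall i, \int[distribution P (u i) \x distribution P (v i)]_z (g i z)%:E < +oo) ->
  \int[P]_w (\prod_i g i (u i w, v i w))%:E =
  \prod_i \int[distribution P (u i) \x distribution P (v i)]_z (g i z)%:E.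
Proof.
move=> g0 mg gfin; apply: (@indep_step M) => // i.
by rewrite leqNgt ltn_ord.
Qed.

End independent_pairs.

(** * Sign averages and moments on the sphere *)

Section exp_bounds.
Variable R : realType.

(** The constant 2, weaker than the sharp 1/2, allows an elementary proof. If a^2 > 1/2 then |a| <=
    2 a^2 bounds both terms; otherwise expR (+-a) <= 1 / (1 -+ a), and the mean 1 / (1 - a^2) is at
    most 1 + 2 a^2. *)
Lemma cosh_le (a : R) : (expR a + expR (- a)) / 2 <= expR (2 * a ^+ 2).
Proof.
have [a2|a2] := leP (a ^+ 2) (1 / 2); last first.
  have ha : `|a| <= 2 * a ^+ 2.
    rewrite -real_normK ?num_real//; have := normr_ge0 a.
    have : 1 / 2 < `|a| ^+ 2 by rewrite real_normK ?num_real.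
    nra.
  have h1 : expR a <= expR (2 * a ^+ 2).
    by rewrite ler_expR (le_trans _ ha)// ler_norm.
  have h2 : expR (- a) <= expR (2 * a ^+ 2).
    by rewrite ler_expR (le_trans _ ha)// -normrN ler_norm.
  lra.
have [a1 a1'] : -1 < a /\ a < 1 by split; nra.
have h1 : expR a <= (1 - a)^-1.
  rewrite -[expR a]invrK -expRN lef_pV2 ?posrE ?expR_gt0 ?subr_gt0//.
  exact: expR_ge1Dx.
have h2 : expR (- a) <= (1 + a)^-1.
  rewrite expRN lef_pV2 ?posrE ?expR_gt0//; last by lra.
  exact: expR_ge1Dx.
have h3 : 1 + 2 * a ^+ 2 <= expR (2 * a ^+ 2) := expR_ge1Dx _.
apply: le_trans h3.
have : ((1 - a)^-1 + (1 + a)^-1) / 2 <= 1 + 2 * a ^+ 2; last by lra.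
have -> : ((1 - a)^-1 + (1 + a)^-1) / 2 = (1 - a ^+ 2)^-1.
  by field; apply/andP; split; [|apply/andP; split]; rewrite gt_eqF//; nra.
rewrite -div1r ler_pdivrMr; last by lra.
by have := sqr_ge0 a; nra.
Qed.

(* Converts second and fourth moments into a lower-tail bound. *)
Lemma expRN_le (y : R) : 0 <= y -> expR (- y) + y ^+ 2 / 2 <= 1 + y ^+ 4 / 8.
Proof.
move=> y0.
have h : expR (- y) <= (1 + y)^-1.
  rewrite expRN lef_pV2 ?posrE ?expR_gt0//; last by lra.
  exact: expR_ge1Dx.
have [y1|y1] := leP y 1.
  suff : (1 + y)^-1 <= 1 - y ^+ 2 / 2.
    have : 0 <= y ^+ 4 by rewrite exprn_ge0.
    lra.
  rewrite -div1r ler_pdivrMr; last by lra.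
  have : 0 <= y * (1 - y) by nra.
  nra.
have h2 : (1 + y)^-1 <= 1 / 2.
  by rewrite -[_^-1]div1r ler_pdivrMr; lra.
have : 0 <= (y ^+ 2 - 2) ^+ 2 by exact: sqr_ge0.
have -> : (y ^+ 2 - 2) ^+ 2 = y ^+ 4 - 4 * y ^+ 2 + 4 by ring.
lra.
Qed.

(* The mean of h (x + sum_i e_i a_i) over independent uniform signs e_i. *)
Fixpoint signavg (h : R -> R) (x : R) (l : seq R) : R :=
  if l is a :: l' then (signavg h (x + a) l' + signavg h (x - a) l') / 2
  else h x.

Lemma signavg_ge0 h x l : (forall y, 0 <= h y) -> 0 <= signavg h x l.
Proof.
by move=> h0; elim: l x => //= a l IH x; rewrite divr_ge0// addr_ge0.
Qed.

(** Each sign contributes a factor cosh a, bounded by [cosh_le]. *)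
Lemma signavg_exp x l :
  signavg expR x l <= expR (x + 2 * \sum_(a <- l) a ^+ 2).
Proof.
elim: l x => [|a l IH] x /=; first by rewrite big_nil mulr0 addr0.
rewrite big_cons; set S := \sum_(a <- l) a ^+ 2 in IH *.
have h := IH (x + a); have h' := IH (x - a).
apply: (@le_trans _ _ (expR (x + 2 * S) * ((expR a + expR (- a)) / 2))).
  rewrite mulrA mulrDr -!expRD.
  have -> : x + 2 * S + a = x + a + 2 * S by ring.
  have -> : x + 2 * S + - a = x - a + 2 * S by ring.
  lra.
have -> : x + 2 * (a ^+ 2 + S) = x + 2 * S + 2 * a ^+ 2 by ring.
by rewrite [leRHS]expRD ler_wpM2l ?expR_ge0// cosh_le.
Qed.

(** Averaging over one sign turns the cross term 2 t x a into 8 t^2 a^2 x^2, so the coefficient t =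
    s / d of x^2 becomes t + 8 t^2 a^2. Lowering d by 8 s a^2 absorbs this, since (1 + y) (1 - y) <=
    1 with y = 8 s a^2 / d. *)
Lemma signavg_sqr (s x : R) l : 0 <= s -> 8 * s * (\sum_(a <- l) a ^+ 2) < 1 ->
  signavg (fun y => expR (s * y ^+ 2)) x l <=
  expR (s / (1 - 8 * s * (\sum_(a <- l) a ^+ 2)) * (x ^+ 2 + \sum_(a <- l) a ^+ 2)).
Proof.
move=> s0; elim: l x => [|a l IH] x /=.
  by rewrite big_nil mulr0 subr0 divr1 addr0.
rewrite big_cons; set S := \sum_(a <- l) a ^+ 2 in IH * => hS.
have S0 : 0 <= S by apply: sumr_ge0 => i _; exact: sqr_ge0.
have sa0 : 0 <= s * a ^+ 2 by rewrite mulr_ge0// sqr_ge0.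
have hS' : 8 * s * S < 1 by lra.
pose d := 1 - 8 * s * S; have d0 : 0 < d by rewrite /d; lra.
have dd : 1 - 8 * s * (a ^+ 2 + S) = d - 8 * (s * a ^+ 2) by rewrite /d; ring.
have d1 : 0 < d - 8 * (s * a ^+ 2) by rewrite -dd; lra.
rewrite dd; set e := d - _ in d1 *.
pose t := s / d.
have t0 : 0 <= t by rewrite divr_ge0// ltW.
have h := IH (x + a) hS'; have h' := IH (x - a) hS'.
rewrite -/d -/t in h h'.
apply: (@le_trans _ _ (expR (t * (x ^+ 2 + (a ^+ 2 + S))) *
    ((expR (2 * t * x * a) + expR (- (2 * t * x * a))) / 2))).
  rewrite mulrA mulrDr -!expRD.
  have -> : t * (x ^+ 2 + (a ^+ 2 + S)) + 2 * t * x * a = t * ((x + a) ^+ 2 + S) by ring.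
  have -> : t * (x ^+ 2 + (a ^+ 2 + S)) + - (2 * t * x * a) = t * ((x - a) ^+ 2 + S) by ring.
  lra.
apply: le_trans (ler_wpM2l (expR_ge0 _) (cosh_le _)) _.
rewrite -expRD ler_expR.
have te : t + 8 * t ^+ 2 * a ^+ 2 <= s / e.
  rewrite ler_pdivlMr// /t.
  have -> : (s / d + 8 * (s / d) ^+ 2 * a ^+ 2) * e =
     s - s * (8 * (s * a ^+ 2) / d) ^+ 2.
    by rewrite /e; field; rewrite gt_eqF.
  by rewrite gerBl mulr_ge0// sqr_ge0.
have te' : t <= s / e.
  apply: le_trans te; rewrite lerDl; have := mulr_ge0 (sqr_ge0 t) (sqr_ge0 a); lra.
have aS : 0 <= a ^+ 2 + S by rewrite addr_ge0// sqr_ge0.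
have := ler_wpM2r (sqr_ge0 x) te; have := ler_wpM2r aS te'; lra.
Qed.

End exp_bounds.

Section borel_vectors.
Variable R : realType.

Lemma continuous_mx (S : topologicalType) m n (f : S -> 'M[R]_(m, n)) :
  (forall i j, continuous (fun x => f x i j)) -> continuous f.
Proof.
move=> cf x A [B nB BA].
have : \forall y \near x, forall i j, B i j (f y i j).
  by apply: filter_forall => i; apply: filter_forall => j; exact: (cf i j x).
by apply: filterS => y hy; apply: BA.
Qed.

Lemma measurable_coord n (i : 'I_n) :
  measurable_fun [set: borel_cV R n] (fun x => (x : 'cV[R]_n) i 0).
Proof.
apply: (measurability _ (RGenOpens.measurableE R)) => _ [_ [a [b ->] <-]].
rewrite setTI; apply: sub_sigma_algebra.
have /continuousP : continuous (fun x : 'cV[R]_n => x i 0) by exact: coord_continuous.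
by apply; exact: interval_open.
Qed.

Lemma measurable_mulmx n (Q : 'M[R]_n) :
  measurable_fun [set: borel_cV R n] (fun x => (Q *m (x : 'cV[R]_n) : borel_cV R n)).
Proof.
apply: (@measurability _ _ (borel_cV R n) (borel_cV R n) _ _ (@open 'cV[R]_n)) => //.
move=> _ [B oB <-]; rewrite setTI; apply: sub_sigma_algebra.
have /continuousP : continuous (fun x : 'cV[R]_n => Q *m x).
  apply: continuous_mx => i j; under eq_fun do rewrite mxE.
  apply: continuous_sumr => k; apply: continuous_mulr; first exact: cst_continuous.
  exact: coord_continuous.
exact.
Qed.

Lemma measurable_dotv n (y : 'cV[R]_n) :
  measurable_fun [set: borel_cV R n] (fun x => dotv y (x : 'cV[R]_n)).
Proof.
apply: measurable_sum => i; apply: measurable_funM; first exact: measurable_cst.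
exact: measurable_coord.
Qed.

Lemma measurable_sqn n : measurable_fun [set: borel_cV R n] (@sqn R n).
Proof.
apply: measurable_sum => i; apply: measurable_funX; exact: measurable_coord.
Qed.

Lemma measurable_sphere n : measurable (@unit_sphere R n).
Proof.
rewrite (_ : @unit_sphere R n = @sqn R n @^-1` [set 1]); last by [].
by rewrite -[X in measurable X]setTI; apply: measurable_sqn.
Qed.

End borel_vectors.

Lemma sqn_delta (R : realType) n (i : 'I_n) : sqn (delta_mx i 0 : 'cV[R]_n) = 1.
Proof.
rewrite /sqn (bigD1 i)//= big1 ?addr0; first by rewrite !mxE !eqxx expr1n.
by move=> j ji; rewrite !mxE (negbTE ji) expr0n.
Qed.

(** * Integrals over the sphere by rotation and reflection *)

Section sphere.
Variables (R : realType) (n : nat) (mu : probability (borel_cV R n) R).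
Hypotheses (n0 : (0 < n)%N) (unif : uniform_on_sphere mu).
Let V := borel_cV R n.
Local Open Scope ereal_scope.

Lemma sphere_cst (c : R) : \int[mu]_x c%:E = c%:E.
Proof.
rewrite integral_cst// -[RHS]mule1; congr (_ * _); exact: probability_setT.
Qed.

Lemma ae_sphere : {ae mu, forall x, @unit_sphere R n x}.
Proof.
exists (~` @unit_sphere R n); split => //.
- by apply: measurableC; exact: measurable_sphere.
- by rewrite probability_setC ?(proj1 unif) ?subee//; exact: measurable_sphere.
Qed.

Lemma sphere_le (f g : V -> R) :
  (forall x, 0 <= f x)%R -> (forall x, 0 <= g x)%R ->
  measurable_fun setT f -> measurable_fun setT g ->
  (forall x, sqn (x : 'cV[R]_n) = 1%R -> f x <= g x)%R ->
  \int[mu]_x (f x)%:E <= \int[mu]_x (g x)%:E.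
Proof.
move=> f0 g0 mf mg fg; apply: ae_ge0_le_integral => //.
- by move=> x _; rewrite lee_fin.
- exact/measurable_EFinP.
- by move=> x _; rewrite lee_fin.
- exact/measurable_EFinP.
- apply: filterS ae_sphere => x sx _; rewrite lee_fin; exact: fg.
Qed.

Lemma sphere_eq (f g : V -> R) :
  (forall x, 0 <= f x)%R -> (forall x, 0 <= g x)%R ->
  measurable_fun setT f -> measurable_fun setT g ->
  (forall x, sqn (x : 'cV[R]_n) = 1%R -> f x = g x)%R ->
  \int[mu]_x (f x)%:E = \int[mu]_x (g x)%:E.
Proof.
move=> f0 g0 mf mg fg; apply/eqP; rewrite eq_le.
by rewrite !sphere_le// => x /fg ->.
Qed.

Lemma sphere_invar (Q : 'M[R]_n) (f : V -> R) : Q^T *m Q = 1%:M ->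
  (forall x, 0 <= f x)%R -> measurable_fun setT f ->
  \int[mu]_x (f (Q *m (x : 'cV[R]_n) : V))%:E = \int[mu]_x (f x)%:E.
Proof.
move=> Qo f0 mf.
rewrite -(@ge0_integral_law _ _ _ _ _ mu _ (measurable_mulmx Q) (EFin \o f)).
- apply: eq_measure_integral => A mA _; exact: (proj2 unif).
- by move=> x; rewrite /= lee_fin.
- exact/measurable_EFinP.
Qed.

(** A reflection carries y to z, so only the length of y matters. The direction is then chosen to
    suit: a coordinate vector for second moments, a constant vector for exponential ones. *)
Lemma sphere_rot (g : R -> R) (y z : 'cV[R]_n) : sqn y = sqn z ->
  (forall x, 0 <= g x)%R -> measurable_fun setT g ->
  \int[mu]_x (g (dotv y (x : 'cV[R]_n)))%:E =
  \int[mu]_x (g (dotv z (x : 'cV[R]_n)))%:E.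
Proof.
move=> yz g0 mg; have [Q [Qo Qy]] := householder yz.
rewrite -[RHS](sphere_invar Qo) => [|x//|]; last first.
  by apply: measurableT_comp mg _; exact: measurable_dotv.
by apply: eq_integral => x _; rewrite -Qy dotv_ortho.
Qed.

(** Rotating y to each coordinate direction gives n equal integrals whose integrands sum to [sqn y]
    on the sphere. *)
Lemma sphere_sqr (y : 'cV[R]_n) :
  \int[mu]_x (dotv y (x : 'cV[R]_n) ^+ 2)%:E = (sqn y / n%:R)%:E.
Proof.
set J := \int[mu]_x _.
pose e i : 'cV[R]_n := (Num.sqrt (sqn y) *: delta_mx i 0)%R.
have JE i : J = \int[mu]_x (sqn y * (x : 'cV[R]_n) i 0 ^+ 2)%R%:E.
  rewrite /J (@sphere_rot (fun t => t ^+ 2)%R y (e i))//.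
  - apply: eq_integral => x _; congr EFin.
    rewrite dotvZl exprMn sqr_sqrtr ?sqn_ge0//; congr (_ * _ ^+ _)%R.
    rewrite /dotv (bigD1 i)//= big1 ?addr0; first by rewrite mxE !eqxx mul1r.
    by move=> j ji; rewrite mxE (negbTE ji) mul0r.
  - by rewrite sqnZ sqr_sqrtr ?sqn_ge0// sqn_delta mulr1.
  - by move=> x; exact: sqr_ge0.
have mi (i : 'I_n) : measurable_fun [set: V] (fun x => (sqn y * (x : 'cV[R]_n) i 0 ^+ 2)%R).
  apply: measurable_funM; first exact: measurable_cst.
  by apply: measurable_funX; exact: measurable_coord.
have : \sum_(i < n) J = (sqn y)%:E.
  rewrite (eq_bigr _ (fun i _ => JE i)).
  rewrite -ge0_integral_sum//; last 2 first.
  - by move=> i; exact/measurable_EFinP.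
  - by move=> i x _; rewrite lee_fin mulr_ge0 ?sqn_ge0// sqr_ge0.
  transitivity (\int[mu]_x (sqn y)%:E); last first.
    by rewrite sphere_cst.
  under eq_integral do rewrite sumEFin -mulr_sumr.
  apply: (@sphere_eq (fun x => sqn y * sqn (x : 'cV[R]_n))%R) => //.
  - by move=> x; rewrite mulr_ge0 ?sqn_ge0.
  - by move=> _; exact: sqn_ge0.
  - apply: measurable_funM; first exact: measurable_cst.
    exact: measurable_sqn.
  - by move=> x ->; rewrite mulr1.
have J0 : 0 <= J by apply: integral_ge0 => x _; rewrite lee_fin sqr_ge0.
have sumJ m : \sum_(i < m) J = m%:R%:E * J.
  elim: m => [|m IH]; first by rewrite big_ord0 mul0e.
  by rewrite big_ord_recr /= IH -[X in _ + X]mul1e -ge0_muleDl// -EFinD natr1.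
rewrite sumJ => nJ.
have -> : J = (n%:R^-1)%:E * (n%:R%:E * J).
  by rewrite muleA -EFinM mulVf ?mul1e// pnatr_eq0 -lt0n.
by rewrite nJ -EFinM mulrC.
Qed.

Lemma measurable_signavg (h : R -> R) (a : 'I_n -> R) (f : V -> R) (l : seq 'I_n) :
  measurable_fun setT h -> measurable_fun setT f ->
  measurable_fun setT (fun x : V =>
    signavg h (f x) [seq (a i * (x : 'cV[R]_n) i 0)%R | i <- l]).
Proof.
move=> mh; elim: l f => [|i l IH] f mf /=; first exact: measurableT_comp mh mf.
have mi : measurable_fun setT (fun x : V => (a i * (x : 'cV[R]_n) i 0)%R).
  apply: measurable_funM; first exact: measurable_cst.
  exact: measurable_coord.
apply: measurable_funM; last exact: measurable_cst.
apply: measurable_funD; apply: IH; first exact: measurable_funD.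
exact: measurable_funB.
Qed.

Lemma sphere_signavg (h : R -> R) (a : 'I_n -> R) :
  (forall x, 0 <= h x)%R -> measurable_fun setT h ->
  \int[mu]_x (h (\sum_i a i * (x : 'cV[R]_n) i 0)%R)%:E =
  \int[mu]_x (signavg h 0 [seq (a i * (x : 'cV[R]_n) i 0)%R | i <- enum 'I_n])%:E.
Proof.
move=> h0 mh.
(* Generalized so that only the coordinates in l carry random signs; each induction step adds one,
   the reflection of that coordinate making the two halves of the average equal. *)
suff gen (l : seq 'I_n) : uniq l ->
    \int[mu]_x (h (\sum_i a i * (x : 'cV[R]_n) i 0)%R)%:E =
    \int[mu]_x (signavg h (\sum_(i | i \notin l) a i * (x : 'cV[R]_n) i 0)%R
      [seq (a i * (x : 'cV[R]_n) i 0)%R | i <- l])%:E.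
  rewrite (gen (enum 'I_n)) ?enum_uniq//; apply: eq_integral => x _.
  by rewrite big1// => i; rewrite mem_enum.
elim: l => [_|i l IH /= /andP[il ul]].
  by apply: eq_integral => x _ /=; congr (h _)%:E; apply: eq_bigl => i.
rewrite IH//; pose f (x : V) := (\sum_(j | j \notin i :: l) a j * (x : 'cV[R]_n) j 0)%R.
have msum (p : pred 'I_n) :
    measurable_fun setT (fun x : V => (\sum_(j | p j) a j * (x : 'cV[R]_n) j 0)%R).
  rewrite (_ : (fun _ => _) =
      fun x : V => (\sum_j (if p j then a j * (x : 'cV[R]_n) j 0 else 0))%R); last first.
    by apply/funext => x; rewrite big_mkcond.
  apply: measurable_sum => j; case: (p j); last exact: measurable_cst.
  apply: measurable_funM; first exact: measurable_cst.
  exact: measurable_coord.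
have mi : measurable_fun setT (fun x : V => (a i * (x : 'cV[R]_n) i 0)%R).
  apply: measurable_funM; first exact: measurable_cst.
  exact: measurable_coord.
pose w (x : V) := [seq (a j * (x : 'cV[R]_n) j 0)%R | j <- l].
pose F (x : V) := signavg h (f x + a i * (x : 'cV[R]_n) i 0)%R (w x).
pose G (x : V) := signavg h (f x - a i * (x : 'cV[R]_n) i 0)%R (w x).
have F0 x : (0 <= F x)%R by exact: signavg_ge0.
have G0 x : (0 <= G x)%R by exact: signavg_ge0.
have mF : measurable_fun setT F.
  by apply: measurable_signavg => //; apply: measurable_funD => //; exact: msum.
have mG : measurable_fun setT G.
  by apply: measurable_signavg => //; apply: measurable_funB => //; exact: msum.
transitivity (\int[mu]_x (F x)%:E).
  apply: eq_integral => x _; rewrite /F /f /w; congr (signavg _ _ _)%:E.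
  rewrite (bigD1 i)//= addrC; congr (_ + _)%R.
  by apply: eq_bigl => j; rewrite in_cons negb_or andbC.
have FG : \int[mu]_x (F x)%:E = \int[mu]_x (G x)%:E.
  pose Q := diag_mx (\row_j (if j == i then -1 else 1)%R) : 'M[R]_n.
  have Qo : Q^T *m Q = 1%:M.
    rewrite /Q tr_diag_mx mulmx_diag -diag_const_mx; congr diag_mx.
    by apply/rowP => j; rewrite !mxE; case: eqP; rewrite ?mulrNN mulr1.
  rewrite -(sphere_invar Qo)//; apply: eq_integral => x _.
  have Qx j : ((Q *m (x : 'cV[R]_n)) j 0 =
      if j == i then - (x : 'cV[R]_n) j 0 else (x : 'cV[R]_n) j 0)%R.
    by rewrite mul_diag_mx !mxE; case: eqP; rewrite ?mulN1r ?mul1r.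
  rewrite /F /G /f /w Qx eqxx mulrN; congr (signavg _ (_ - _)%R _)%:E.
    apply: eq_bigr => j; rewrite Qx in_cons negb_or => /andP[ji _].
    by rewrite (negbTE ji).
  apply/eq_in_map => j jl; rewrite Qx; case: eqP => // ji.
  by rewrite -ji jl in il.
transitivity (2^-1%:E * (\int[mu]_x (F x)%:E + \int[mu]_x (G x)%:E)).
  rewrite -FG -[X in (X + _)]mul1e -[X in (_ + X)]mul1e -ge0_muleDl//.
  by rewrite muleA -!EFinD -EFinM (_ : (2^-1 * (1 + 1) = 1)%R) ?mul1e//; field.
rewrite -ge0_integralD//; last 4 first.
- by move=> x _; rewrite lee_fin.
- exact/measurable_EFinP.
- by move=> x _; rewrite lee_fin.
- exact/measurable_EFinP.
rewrite -ge0_integralZl//; last 2 first.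
- by apply: emeasurable_funD; exact/measurable_EFinP.
- by move=> x _; rewrite adde_ge0// lee_fin.
apply: eq_integral => x _; rewrite -EFinD -EFinM /=; congr EFin.
by rewrite mulrC.
Qed.

(** Once y is rotated to a constant vector, the squares of the signed terms sum to sqn y / n at
    every point of the sphere, so the sign average has a uniform bound. *)
Lemma sphere_mgf (y : 'cV[R]_n) :
  \int[mu]_x (expR (dotv y (x : 'cV[R]_n)))%:E <= (expR (2 * sqn y / n%:R))%:E.
Proof.
have nR : n%:R != 0%R :> R by rewrite pnatr_eq0 -lt0n.
pose c := (sqn y / n%:R)%R; have c0 : (0 <= c)%R by rewrite divr_ge0// sqn_ge0.
rewrite (@sphere_rot _ y (const_mx (Num.sqrt c)))//; last first.
- rewrite /sqn; under [RHS]eq_bigr do rewrite mxE sqr_sqrtr//.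
  by rewrite sumr_const card_ord -mulr_natr divfK.
rewrite (eq_integral (fun x : V => (expR (\sum_i Num.sqrt c * (x : 'cV[R]_n) i 0)%R)%:E)); last first.
  by move=> x _; rewrite /dotv; under eq_bigr do rewrite mxE.
rewrite sphere_signavg//.
apply: (@le_trans _ _ (\int[mu]_x (expR (2 * c))%:E)); last first.
  by rewrite sphere_cst /c mulrA.
apply: sphere_le => //.
- by move=> x; apply: signavg_ge0 => z; exact: expR_ge0.
- by apply: measurable_signavg => //; exact: measurable_cst.
move=> x x1; apply: le_trans (signavg_exp _ _) _.
rewrite add0r big_map big_enum /= ler_expR ler_wpM2l//.
under eq_bigr do rewrite exprMn sqr_sqrtr//.
by rewrite -mulr_sumr -/(sqn x) x1 mulr1.
Qed.

Lemma sphere_chaos (s : R) (y : 'cV[R]_n) : sqn y = 1%R -> (0 <= s)%R -> (8 * s < 1)%R ->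
  \int[mu]_x (expR (s * (n%:R * dotv y (x : 'cV[R]_n) ^+ 2)))%:E <=
  (expR (s / (1 - 8 * s)))%:E.
Proof.
move=> y1 s0 s1; have nR : (0 < n%:R :> R)%R by rewrite ltr0n.
have mh (c : R) : measurable_fun [set: R] (fun t => expR (s * (c * t ^+ 2)))%R.
  apply: measurableT_comp => //; apply: measurable_funM; first exact: measurable_cst.
  apply: measurable_funM; first exact: measurable_cst.
  exact: exprn_measurable.
rewrite (@sphere_rot (fun t => expR (s * (n%:R * t ^+ 2)))%R y (const_mx (Num.sqrt n%:R^-1)))//; last first.
- rewrite /sqn; under [RHS]eq_bigr do rewrite mxE sqr_sqrtr ?invr_ge0//.
  by rewrite sumr_const card_ord -[RHS]mulr_natr mulVf ?gt_eqF.
(* The entries n^(-1/2) cancel the factor n. The coefficients 1 inside the sum give the linear form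
   expected by [sphere_signavg]. *)
rewrite (eq_integral (fun x : V => (expR (s * (1 * (\sum_i 1 * (x : 'cV[R]_n) i 0) ^+ 2)))%R%:E)); last first.
  move=> x _; rewrite /dotv; under eq_bigr do rewrite mxE.
  congr (expR (_ * _))%:E.
  rewrite -!mulr_sumr !exprMn sqr_sqrtr ?invr_ge0// mulrA divff ?gt_eqF//.
  by rewrite expr1n mul1r.
rewrite (@sphere_signavg (fun t => expR (s * (1 * t ^+ 2)))%R)//.
apply: (@le_trans _ _ (\int[mu]_x (expR (s / (1 - 8 * s)))%:E)); last first.
  by rewrite sphere_cst.
apply: sphere_le => //.
- by move=> x; apply: signavg_ge0 => z; exact: expR_ge0.
- by apply: measurable_signavg => //; exact: measurable_cst.
move=> x x1.
have SE : (\sum_(b <- [seq (1 * (x : 'cV[R]_n) i 0)%R | i <- enum 'I_n]) b ^+ 2 = 1)%R.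
  by rewrite big_map big_enum /= -[RHS]x1; apply: eq_bigr => i _; rewrite mul1r.
have -> : ((fun t => expR (s * (1 * t ^+ 2))) = (fun t => expR (s * t ^+ 2)))%R.
  by apply/funext => t; rewrite mul1r.
apply: le_trans (signavg_sqr _ _ _) _ => //; first by rewrite SE mulr1.
by rewrite SE mulr1 expr0n add0r mulr1.
Qed.

End sphere.

(** * Concentration for one matrix *)

Section bilinear.
Variables (R : realType) (n : nat).
Let V := borel_cV R n.

(** The factor n normalizes the second moment to 1 when [frob2 A = 1]; see [pair_sq]. *)
Definition bil (A : 'M[R]_n) (z : V * V) : R :=
  n%:R * dotv (z.1 : 'cV[R]_n) (A *m (z.2 : 'cV[R]_n)).

Lemma measurable_bil A : measurable_fun setT (bil A).
Proof.
apply: measurable_funM; first exact: measurable_cst.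
apply: measurable_sum => i; apply: measurable_funM.
  exact: measurableT_comp (measurable_coord i) measurable_fst.
rewrite (_ : (fun _ => _) =
    (fun z : V * V => \sum_j A i j * (z.2 : 'cV[R]_n) j 0)); last first.
  by apply/funext => z; rewrite mxE.
apply: measurable_sum => j; apply: measurable_funM; first exact: measurable_cst.
exact: measurableT_comp (measurable_coord j) measurable_snd.
Qed.

Lemma bilE (A : 'M[R]_n) (x y : V) :
  bil A (x, y) = dotv (n%:R *: (A^T *m (x : 'cV[R]_n))) (y : 'cV[R]_n).
Proof. by rewrite /bil /= dotvZl dotvMl trmxK. Qed.

Lemma bilN (A : 'M[R]_n) z : bil (- A) z = - bil A z.
Proof. by rewrite /bil mulNmx -scaleN1r dotvZr mulrCA mulN1r. Qed.

(** The exponential lies above its tangent line at the weighted mean. *)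
Lemma jensen_exp (p w : 'I_n -> R) : (forall i, 0 <= p i) -> \sum_i p i = 1 ->
  expR (\sum_i p i * w i) <= \sum_i p i * expR (w i).
Proof.
move=> p0 p1; set m := \sum_i p i * w i.
have h i : p i * (expR m * (1 + (w i - m))) <= p i * expR (w i).
  have -> : expR (w i) = expR m * expR (w i - m) by rewrite -expRD addrC subrK.
  by rewrite !ler_wpM2l ?expR_ge0// expR_ge1Dx.
apply: le_trans (ler_sum _ (fun i _ => h i)).
have -> : \sum_i p i * (expR m * (1 + (w i - m))) =
    expR m * (\sum_i p i + (\sum_i p i * w i - m * \sum_i p i)).
  rewrite mulr_sumr -sumrB -big_split mulr_sumr; apply: eq_bigr => i _ /=; ring.
by rewrite p1 mulr1 subrr addr0 mulr1.
Qed.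

Lemma expR_abs_le (y : R) : expR `|y| <= expR y + expR (- y).
Proof.
case: (ger0P y) => _; first by rewrite lerDl expR_ge0.
by rewrite lerDr expR_ge0.
Qed.

Lemma pow4_le (y : R) : 0 <= y -> y ^+ 4 <= 256 * expR y.
Proof.
move=> y0; have -> : 256 * expR y = (4 * expR (y / 4)) ^+ 4.
  rewrite exprMn -expRM_natl -mulr_natl; congr (_ * expR _); first by ring.
  by rewrite mulrCA divff ?mulr1.
rewrite lerXn2r ?nnegrE ?mulr_ge0 ?expR_ge0//.
have := expR_ge1Dx (y / 4); lra.
Qed.

End bilinear.

Section bilinear_moments.
Variables (R : realType) (n : nat) (mu nu : probability (borel_cV R n) R).
Hypotheses (n0 : (0 < n)%N) (umu : uniform_on_sphere mu) (unu : uniform_on_sphere nu).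
Let V := borel_cV R n.
Variable A : 'M[R]_n.
Hypothesis A1 : frob2 A = 1.
Local Open Scope ereal_scope.

Lemma measurable_sqn_mulmx (B : 'M[R]_n) :
  measurable_fun [set: V] (fun x => sqn (B *m (x : 'cV[R]_n))).
Proof. exact: measurableT_comp (@measurable_sqn R n) (measurable_mulmx B). Qed.

(** In an SVD of A the exponent is a mean of s n <u_i, x>^2 with weights t_i^2, which sum to
    [frob2 A = 1]. Jensen reduces to a single direction, at no cost in the rank of A. *)
Lemma chaos_mx (s : R) : (0 <= s)%R -> (8 * s < 1)%R ->
  \int[mu]_x (expR (s * (n%:R * sqn (A^T *m (x : 'cV[R]_n)))))%:E <=
  (expR (s / (1 - 8 * s)))%:E.
Proof.
move=> s0 s1; have [U [W [t [Uo Wo t0 AE]]]] := svd A.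
have t1 : (\sum_i t 0%R i ^+ 2 = 1)%R by rewrite -A1 AE frob2_ortho// frob2_diag.
pose f i (x : V) := (t 0 i ^+ 2 * expR (s * (n%:R * dotv (col i U) (x : 'cV[R]_n) ^+ 2)))%R.
have f0 i x : (0 <= f i x)%R by rewrite mulr_ge0 ?sqr_ge0 ?expR_ge0.
have me i : measurable_fun [set: V]
    (fun x => expR (s * (n%:R * dotv (col i U) (x : 'cV[R]_n) ^+ 2)))%R.
  apply: measurableT_comp => //; do 2 (apply: measurable_funM; first exact: measurable_cst).
  by apply: measurable_funX; exact: measurable_dotv.
have mf i : measurable_fun [set: V] (f i).
  by apply: measurable_funM; [exact: measurable_cst|exact: me].
apply: (@le_trans _ _ (\int[mu]_x (\sum_i f i x)%R%:E)).
  apply: sphere_le => //.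
  - by move=> x; apply: sumr_ge0 => i _.
  - apply: measurableT_comp => //; do 2 (apply: measurable_funM; first exact: measurable_cst).
    exact: measurable_sqn_mulmx.
  - exact: measurable_sum.
  move=> x _; have := @jensen_exp R n (fun i => t 0 i ^+ 2)%R
    (fun i => s * (n%:R * dotv (col i U) (x : 'cV[R]_n) ^+ 2))%R (fun i => sqr_ge0 _) t1.
  apply: le_trans; rewrite ler_expR AE !trmx_mul trmxK tr_diag_mx -!mulmxA sqn_ortho//.
  rewrite /sqn !mulr_sumr; apply: ler_sum => i _; rewrite mul_diag_mx mxE.
  have -> : (U^T *m (x : 'cV[R]_n)) i 0%R = dotv (col i U) (x : 'cV[R]_n).
    by rewrite mxE; apply: eq_bigr => j _; rewrite !mxE.
  by rewrite le_eqVlt; apply/orP; left; apply/eqP; ring.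
under eq_integral do rewrite -sumEFin.
rewrite ge0_integral_sum//; last 2 first.
- by move=> i; exact/measurable_EFinP.
- by move=> i x _; rewrite lee_fin.
apply: (@le_trans _ _ (\sum_i ((t 0 i ^+ 2 * expR (s / (1 - 8 * s)))%R)%:E)).
  apply: lee_sum => i _; rewrite /f.
  under eq_integral do rewrite EFinM.
  rewrite ge0_integralZl//; last 2 first.
  - exact/measurable_EFinP.
  - by rewrite lee_fin sqr_ge0.
  rewrite [leRHS]EFinM lee_wpmul2l ?lee_fin ?sqr_ge0//.
  by apply: sphere_chaos => //; exact: sqn_col_ortho.
by rewrite sumEFin -mulr_suml t1 mul1r.
Qed.

(** For fixed x, [sphere_mgf] in y yields the exponent n |A^T x|^2 / 32. Scale 8 thus leads to s =
    1/32 in [chaos_mx], well within 8 s < 1, and s / (1 - 8 s) = 1/24. *)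
Lemma pair_mgf : \int[mu \x nu]_z (expR (bil A z / 8))%:E <= (expR (1 / 24))%:E.
Proof.
have mE : measurable_fun setT (fun z : V * V => (expR (bil A z / 8))%:E).
  apply/measurable_EFinP; apply: measurableT_comp => //.
  by apply: measurable_funM; [exact: measurable_bil|exact: measurable_cst].
rewrite fubini_tonelli1//.
apply: (@le_trans _ _ (\int[mu]_x (expR (1 / 32 * (n%:R * sqn (A^T *m (x : 'cV[R]_n)))))%:E)).
  apply: ge0_le_integral => //.
  - by move=> x _; apply: integral_ge0 => y _; rewrite lee_fin expR_ge0.
  - apply: measurable_fun_fubini_tonelli_F => //.
  - apply/measurable_EFinP; apply: measurableT_comp => //.
    do 2 (apply: measurable_funM; first exact: measurable_cst).
    exact: measurable_sqn_mulmx.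
  move=> x _; rewrite /fubini_F.
  rewrite (eq_integral (fun y : V =>
      (expR (dotv ((n%:R / 8) *: (A^T *m (x : 'cV[R]_n)))%R (y : 'cV[R]_n)))%:E)); last first.
    by move=> y _; rewrite bilE !dotvZl mulrAC.
  apply: le_trans (sphere_mgf n0 unu _) _; rewrite lee_fin ler_expR sqnZ.
  rewrite le_eqVlt; apply/orP; left; apply/eqP; field.
  by rewrite pnatr_eq0 -lt0n.
have s0 : (0 <= 1 / 32 :> R)%R by lra.
have s1 : (8 * (1 / 32) < 1 :> R)%R by lra.
apply: le_trans (chaos_mx s0 s1) _.
have -> : (1 / 32 / (1 - 8 * (1 / 32)) = 1 / 24 :> R)%R by field.
by [].
Qed.

Lemma pair_sq : \int[mu \x nu]_z (bil A z ^+ 2)%:E = 1.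
Proof.
have nR : n%:R != 0%R :> R by rewrite pnatr_eq0 -lt0n.
rewrite fubini_tonelli1//; last 2 first.
- apply/measurable_EFinP; apply: measurable_funX; exact: measurable_bil.
- by move=> z; rewrite lee_fin sqr_ge0.
transitivity (\int[mu]_x (\sum_j n%:R * dotv (col j A) (x : 'cV[R]_n) ^+ 2)%R%:E).
  apply: eq_integral => x _; rewrite /fubini_F.
  under eq_integral do rewrite bilE.
  rewrite sphere_sqr// sqnZ; congr EFin.
  transitivity (n%:R * sqn (A^T *m (x : 'cV[R]_n)))%R; first by field.
  rewrite /sqn mulr_sumr; apply: eq_bigr => j _; congr (_ * _ ^+ _)%R.
  by rewrite mxE; apply: eq_bigr => i _; rewrite !mxE.
under eq_integral do rewrite -sumEFin.
rewrite ge0_integral_sum//; last 2 first.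
- move=> j; apply/measurable_EFinP; apply: measurable_funM; first exact: measurable_cst.
  apply: measurable_funX; exact: measurable_dotv.
- by move=> j x _; rewrite lee_fin mulr_ge0// sqr_ge0.
transitivity (\sum_j (sqn (col j A))%:E).
  apply: eq_bigr => j _; under eq_integral do rewrite EFinM.
  rewrite ge0_integralZl//; last 2 first.
  - apply/measurable_EFinP; apply: measurable_funX; exact: measurable_dotv.
  - by move=> x _; rewrite lee_fin sqr_ge0.
  by rewrite sphere_sqr// -EFinM mulrCA divff// mulr1.
rewrite sumEFin -[X in _ = X%:E]A1 /frob2 exchange_big; congr EFin.
by apply: eq_bigr => j _; apply: eq_bigr => i _; rewrite mxE.
Qed.

End bilinear_moments.

Section bilinear_tails.
Variables (R : realType) (n : nat) (mu nu : probability (borel_cV R n) R).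
Hypotheses (n0 : (0 < n)%N) (umu : uniform_on_sphere mu) (unu : uniform_on_sphere nu).
Let V := borel_cV R n.
Variable A : 'M[R]_n.
Hypothesis A1 : frob2 A = 1.
Local Open Scope ereal_scope.

Lemma measurable_bil_abs (f : R -> R) : measurable_fun setT f ->
  measurable_fun setT (fun z : V * V => f `|bil A z|%R).
Proof.
move=> mf; apply: measurableT_comp mf _; apply: measurableT_comp => //.
exact: measurable_bil.
Qed.

Lemma measurable_exp8 : measurable_fun [set: R] (fun t => expR (t / 8))%R.
Proof. by apply: measurableT_comp => //; apply: measurable_funM. Qed.

Lemma pair_abs : \int[mu \x nu]_z (expR (`|bil A z| / 8))%:E <= 4%:E.
Proof.
have mB (B : 'M[R]_n) : measurable_fun setT (fun z : V * V => (expR (bil B z / 8))%:E).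
  apply/measurable_EFinP; apply: measurableT_comp => //.
  by apply: measurable_funM; [exact: measurable_bil|exact: measurable_cst].
apply: (@le_trans _ _ (\int[mu \x nu]_z ((expR (bil A z / 8))%:E + (expR (bil (- A) z / 8))%:E))).
  apply: ge0_le_integral => //.
  - by apply/measurable_EFinP; apply: (@measurable_bil_abs (fun t => expR (t / 8))%R); exact: measurable_exp8.
  - exact: emeasurable_funD.
  move=> z _; rewrite -EFinD lee_fin bilN mulNr.
  have -> : (`|bil A z| / 8 = `|bil A z / 8|)%R by rewrite [RHS]normrM normfV (ger0_norm (ler0n R 8)).
  exact: expR_abs_le.
rewrite ge0_integralD//.
have AN : frob2 (- A) = 1%R.
  by rewrite -A1; do 2 (apply: eq_bigr => ? _); rewrite mxE sqrrN.
apply: le_trans (leeD (pair_mgf n0 umu unu A1) (pair_mgf n0 umu unu AN)) _.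
rewrite -EFinD lee_fin.
have : (expR (1 / 24) <= 2 :> R)%R.
  rewrite -[expR _]invrK -expRN -[leRHS]invrK lef_pV2 ?posrE ?expR_gt0 ?invr_gt0//.
  have := expR_ge1Dx (- (1 / 24) : R); lra.
lra.
Qed.

(** Let t = |bil A z| / 8. By [expRN_le] the mean of expR (- q t) is at most 1 - (q^2/2) E t^2 +
    (q^4/8) E t^4. Here E t^2 = 1/64, and t^4 <= 256 expR t with [pair_abs] bounds the last term by
    128 q^4, at most half of the gain q^2/128 for the allowed q. *)
Lemma pair_low (q : R) : (0 <= q)%R -> (256 * q <= 1)%R ->
  \int[mu \x nu]_z (expR (- (q / 8 * `|bil A z|)))%:E <= (expR (- (q ^+ 2 / 256)))%:E.
Proof.
move=> q0 q1.
pose t (z : V * V) := (`|bil A z| / 8)%R.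
have t0 z : (0 <= t z)%R by rewrite divr_ge0.
have mt (f : R -> R) : measurable_fun setT f -> measurable_fun setT (fun z => (f (t z))%:E).
  move=> mf; apply/measurable_EFinP; apply: (@measurable_bil_abs (fun s => f (s / 8))%R).
  apply: measurableT_comp mf _; exact: measurable_funM.
have mL : measurable_fun setT (fun z => (expR (- (q * t z)))%:E).
  apply: (mt (fun s => expR (- (q * s)))).
  by apply: measurableT_comp => //; apply: measurableT_comp => //; apply: measurable_funM.
have mE : measurable_fun setT (fun z => (expR (t z))%:E) by exact: mt.
have mS : measurable_fun setT (fun z => (t z ^+ 2)%:E).
  by apply: (mt (fun s => s ^+ 2)%R); exact: measurable_funX.
pose c := (q ^+ 2 / 2)%R; have c0 : (0 <= c)%R by rewrite divr_ge0// sqr_ge0.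
pose e := (32 * q ^+ 4)%R; have e0 : (0 <= e)%R by rewrite mulr_ge0// exprn_ge0.
(* The negative term stands on the left, so that both integrands are nonnegative. *)
have h : \int[mu \x nu]_z ((expR (- (q * t z)))%:E + c%:E * (t z ^+ 2)%:E) <=
     \int[mu \x nu]_z (1 + e%:E * (expR (t z))%:E).
  apply: ge0_le_integral => //.
  - by move=> z _; rewrite -EFinM -EFinD lee_fin addr_ge0 ?expR_ge0// mulr_ge0// sqr_ge0.
  - by apply: emeasurable_funD => //; apply: emeasurable_funM => //; exact: measurable_cst.
  - apply: emeasurable_funD; first exact: measurable_cst.
    by apply: emeasurable_funM => //; exact: measurable_cst.
  move=> z _; rewrite -!EFinM -!EFinD lee_fin.
  move: (t z) (t0 z) => x x0.
  have h1 := expRN_le (mulr_ge0 q0 x0).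
  have h3 : (0 <= q ^+ 4)%R by rewrite exprn_ge0.
  have h4 := ler_wpM2l h3 (pow4_le x0).
  rewrite !exprMn in h1; rewrite /c /e.
  move: h1 h4; move: (q ^+ 4)%R (q ^+ 2)%R (x ^+ 4)%R (x ^+ 2)%R (expR x) => a b y z' w.
  lra.
have J0 : 0 <= \int[mu \x nu]_z (expR (- (q * t z)))%:E.
  by apply: integral_ge0 => z _; rewrite lee_fin expR_ge0.
rewrite ge0_integralD// in h; last 2 first.
- by move=> z _; rewrite -EFinM lee_fin mulr_ge0// sqr_ge0.
- by apply: emeasurable_funM => //; exact: measurable_cst.
rewrite ge0_integralD// in h; last 2 first.
- by move=> z _; rewrite -EFinM lee_fin mulr_ge0// expR_ge0.
- by apply: emeasurable_funM => //; exact: measurable_cst.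
rewrite ge0_integralZl// in h; last by move=> z _; rewrite lee_fin sqr_ge0.
rewrite ge0_integralZl// in h.
have I2 : \int[mu \x nu]_z (t z ^+ 2)%:E = (1 / 64)%:E.
  transitivity (\int[mu \x nu]_z ((1 / 64)%:E * (bil A z ^+ 2)%:E)).
    apply: eq_integral => z _; rewrite -EFinM; congr EFin.
    by rewrite exprMn real_normK ?num_real// mulrC; congr (_ * _)%R; field.
  rewrite ge0_integralZl//.
  - by rewrite pair_sq// mule1.
  - by apply/measurable_EFinP; apply: measurable_funX; exact: measurable_bil.
  - by move=> z _; rewrite lee_fin sqr_ge0.
have I1 : \int[mu \x nu]_z 1 = 1.
  rewrite integral_cst// mul1e; exact: probability_setT.
rewrite I1 I2 in h.
have LE : \int[mu \x nu]_z (expR (- (q / 8 * `|bil A z|)))%:E =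
    \int[mu \x nu]_z (expR (- (q * t z)))%:E.
  by apply: eq_integral => z _; rewrite /t mulrAC mulrA.
have {}h : \int[mu \x nu]_z (expR (- (q * t z)))%:E + (c * (1 / 64))%:E <=
    (1 + e * 4)%:E.
  rewrite EFinM; apply: le_trans h _; rewrite EFinD leeD2l//.
  by rewrite [leRHS]EFinM lee_wpmul2l// pair_abs.
rewrite LE -leeBrDr// -EFinB in h *; apply: le_trans h _; rewrite lee_fin.
have := expR_ge1Dx (- (q ^+ 2 / 256)); rewrite /c /e => h.
have h2' : (256 * q ^+ 2 <= q)%R by have := ler_wpM2r q0 q1; rewrite expr2; lra.
have h2 : (128 * q ^+ 2 <= 1 / 256)%R by lra.
have h3 : (q ^+ 4 = q ^+ 2 * q ^+ 2)%R by rewrite -exprD.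
have := ler_wpM2l (sqr_ge0 q) h2; rewrite h3; lra.
Qed.

End bilinear_tails.

(** * Chernoff bounds for sums over the sample *)

Section chernoff.
Context d d' (Omega : measurableType d) (T : measurableType d') (R : realType).
Context (P : probability Omega R) (M : nat) (u v : 'I_M -> {RV P >-> T}).
Hypothesis ind : mutually_independent (joint_family u v).
Local Open Scope ereal_scope.

Lemma le_prob_integral (E : set Omega) (f : Omega -> R) : measurable E ->
  measurable_fun setT f -> (forall w, 0 <= f w)%R -> (forall w, E w -> 1 <= f w)%R ->
  P E <= \int[P]_w (f w)%:E.
Proof.
move=> mE mf f0 f1; have -> : P E = \int[P]_w (\1_E w)%:E by rewrite integral_indic// setIT.
apply: ge0_le_integral => //.
- by apply/measurable_EFinP.
- by apply/measurable_EFinP.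
move=> w _; rewrite lee_fin indicE; case: (boolP (w \in E)) => [/set_mem/f1//|_].
exact: f0.
Qed.

(** Markov's inequality for a product, factored by independence. Domination of E by the product is a
    hypothesis, so the same lemma covers both tails. *)
Lemma chernoff_pairs (g : T * T -> R) (b : R) (E : set Omega) :
  (forall z, 0 <= g z)%R -> measurable_fun setT g ->
  (forall i, \int[distribution P (u i) \x distribution P (v i)]_z (g z)%:E <= (expR (- b))%:E) ->
  measurable E -> (forall w, E w -> 1 <= \prod_(i < M) g (u i w, v i w))%R ->
  P E <= (expR (- (b * M%:R)))%:E.
Proof.
move=> g0 mg gb mE E1.
apply: (@le_trans _ _ (\int[P]_w (\prod_(i < M) g (u i w, v i w))%R%:E)).
  apply: le_prob_integral => //; last by move=> w; apply: prodr_ge0.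
  apply: measurable_prod => i _; apply: measurableT_comp mg _.
  exact: measurable_fun_pair.
rewrite (@indep_prod _ _ _ _ _ P M u v ind (fun=> g))//; last first.
  by move=> i; apply: le_lt_trans (gb i) _; exact: ltry.
have -> : (expR (- (b * M%:R)))%:E = \prod_(i < M) (expR (- b))%:E.
  rewrite prodEFin prodr_const card_ord -expRM_natl; congr (expR _)%:E.
  by rewrite mulrN mulrC.
suff [] : 0 <= \prod_(i < M) \int[distribution P (u i) \x distribution P (v i)]_z (g z)%:E /\
  \prod_(i < M) \int[distribution P (u i) \x distribution P (v i)]_z (g z)%:E <=
  \prod_(i < M) (expR (- b))%:E by [].
elim/big_ind2 : _ => [|x x' y y' [x0 xx'] [y0 yy']|i _].
- by rewrite lexx lee_fin.
- by rewrite mule_ge0// lee_pmul.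
- by split => //; apply: integral_ge0 => z _; rewrite lee_fin.
Qed.

End chernoff.

Section single_matrix.
Context d (Omega : measurableType d) (R : realType) (P : probability Omega R).
Context (n M : nat) (u v : 'I_M -> {RV P >-> borel_cV R n}).
Hypotheses (n0 : (0 < n)%N) (ind : mutually_independent (joint_family u v)).
Hypothesis uu : forall i, uniform_on_sphere (distribution P (u i)).
Hypothesis uv : forall i, uniform_on_sphere (distribution P (v i)).
Let V := borel_cV R n.
Variable q : R.
Hypotheses (q0 : 0 < q) (q1 : 256 * q <= 1).

Definition absum (A : 'M[R]_n) (w : Omega) : R :=
  \sum_(i < M) `|bil A (u i w, v i w)|.

Lemma measurable_absum A : measurable_fun setT (absum A).
Proof.
apply: measurable_sum => i; apply: measurableT_comp => //.
apply: (measurableT_comp (measurable_bil A)); exact: measurable_fun_pair.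
Qed.

Lemma absumZ a A w : absum (a *: A) w = `|a| * absum A w.
Proof.
rewrite mulr_sumr; apply: eq_bigr => i _; rewrite -normrM; congr `|_|.
by rewrite /bil -scalemxAl dotvZr mulrCA.
Qed.

(** The threshold is 24 = 8 * 3: subtracting 3 from |bil| / 8 leaves the mean 4 expR (- 3) <= expR
    (- 1). *)
Lemma absum_up A : frob2 A = 1 ->
  (P [set w | (24 * M%:R <= absum A w)%R] <= (expR (- M%:R))%R%:E)%E.
Proof.
move=> A1; rewrite -(mul1r M%:R).
apply: (@chernoff_pairs _ _ _ _ _ P M u v ind (fun z => expR (`|bil A z| / 8 - 3))).
- by move=> z; exact: expR_ge0.
- apply: (@measurable_bil_abs R n A (fun t => expR (t / 8 - 3))).
  apply: measurableT_comp => //; apply: measurable_funB => //.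
  exact: measurable_funM.
- move=> i; under eq_integral do rewrite expRD EFinM muleC.
  rewrite ge0_integralZl//; last first.
  + apply/measurable_EFinP; apply: (@measurable_bil_abs R n A (fun t => expR (t / 8))).
    exact: measurable_exp8.
  apply: le_trans (lee_wpmul2l _ (pair_abs n0 (uu i) (uv i) A1)) _.
    by rewrite lee_fin expR_ge0.
  rewrite -EFinM lee_fin.
  have -> : (- 3 : R) = - 1 + - 1 + - 1 by ring.
  rewrite !expRD.
  have h : expR (- 1) <= 2^-1 :> R.
    rewrite expRN lef_pV2 ?posrE ?expR_gt0//.
    by have := expR_ge1Dx (1 : R); lra.
  have := expR_ge0 (- 1 : R); move: (expR (- 1)) h => x h x0.
  have : x * x <= 1 / 4 by nra.
  nra.
- rewrite -[X in measurable X]setTI; apply: (measurable_fun_ler _ (measurable_absum A)) => //.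
- move=> w /=; rewrite mul1r -expR_sum => h; apply: le_trans (expR_ge1Dx _); rewrite lerDl sumrB -mulr_suml.
  rewrite sumr_const card_ord -/(absum A w) -mulr_natr; lra.
Qed.

Definition rate : R := q ^+ 2 / 512.

(** Half of the exponent q^2/256 from [pair_low] pays for the threshold, as (q/8) (q/64) = q^2/512;
    the other half is [rate]. *)
Lemma absum_low A : frob2 A = 1 ->
  (P [set w | (absum A w <= q / 64 * M%:R)%R] <= (expR (- (rate * M%:R)))%R%:E)%E.
Proof.
move=> A1.
apply: (@chernoff_pairs _ _ _ _ _ P M u v ind
  (fun z => expR (- (q / 8 * `|bil A z|) + q ^+ 2 / 512))).
- by move=> z; exact: expR_ge0.
- apply: (@measurable_bil_abs R n A (fun t => expR (- (q / 8 * t) + q ^+ 2 / 512))).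
  apply: measurableT_comp => //; apply: measurable_funD => //.
  by apply: measurableT_comp => //; exact: measurable_funM.
- move=> i; under eq_integral do rewrite expRD EFinM muleC.
  rewrite ge0_integralZl//; last first.
  + apply/measurable_EFinP; apply: (@measurable_bil_abs R n A (fun t => expR (- (q / 8 * t)))).
    apply: measurableT_comp => //.
    by apply: measurableT_comp => //; exact: measurable_funM.
  apply: le_trans (lee_wpmul2l _ (pair_low n0 (uu i) (uv i) A1 (ltW q0) q1)) _.
    by rewrite lee_fin expR_ge0.
  by rewrite -EFinM lee_fin -expRD ler_expR /rate; lra.
- rewrite -[X in measurable X]setTI; apply: (measurable_fun_ler (measurable_absum A)) => //.
- move=> w /=; rewrite -expR_sum => h; apply: le_trans (expR_ge1Dx _); rewrite lerDl big_split sumrN -mulr_sumr /=.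
  rewrite sumr_const card_ord -/(absum A w) -mulr_natr.
  have := ler_wpM2l (ltW q0) h; rewrite /rate; lra.
Qed.

Definition bad (A : 'M[R]_n) := [set w | ~~ (q / 64 * M%:R * Num.sqrt (frob2 A) <=
  absum A w <= 24 * M%:R * Num.sqrt (frob2 A))].

Lemma measurable_bad A : measurable (bad A).
Proof.
rewrite (_ : bad A = ~` ([set w | q / 64 * M%:R * Num.sqrt (frob2 A) <= absum A w] `&`
   [set w | absum A w <= 24 * M%:R * Num.sqrt (frob2 A)])); last first.
  by apply/seteqP; split => w /=; [move=> /negP h [a b]; apply: h; rewrite a b|
    move=> h; apply/negP => /andP].
apply: measurableC; apply: measurableI; rewrite -[X in measurable X]setTI.
  exact: (measurable_fun_ler _ (measurable_absum A)).
exact: (measurable_fun_ler (measurable_absum A)).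
Qed.

Lemma prob_bad_le A : (P (bad A) <= (2 * expR (- (rate * M%:R)))%R%:E)%E.
Proof.
have [->|A0] := eqVneq A 0.
  rewrite (_ : bad 0 = set0) ?measure0 ?lee_fin ?mulr_ge0 ?expR_ge0//.
  apply/seteqP; split => // w /=; rewrite /bad /= (_ : frob2 (0 : 'M[R]_n) = 0); last first.
    by apply/eqP; rewrite frob2_eq0.
  rewrite sqrtr0 !mulr0 -(scale0r (0 : 'M[R]_n)) absumZ normr0 mul0r lexx.
  by [].
have N0 : 0 < frob2 A by rewrite lt_def frob2_eq0 A0 frob2_ge0.
pose a := Num.sqrt (frob2 A); have a0 : 0 < a by rewrite sqrtr_gt0.
pose B := a^-1 *: A.
have B1 : frob2 B = 1.
  transitivity (a^-1 ^+ 2 * frob2 A).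
    rewrite /frob2 mulr_sumr; apply: eq_bigr => i _; rewrite mulr_sumr.
    by apply: eq_bigr => j _; rewrite mxE exprMn.
  by rewrite exprVn sqr_sqrtr ?frob2_ge0// mulVf// gt_eqF.
have AB w : absum A w = a * absum B w.
  by rewrite absumZ ger0_norm ?invr_ge0 ?ltW// mulrA divff ?mul1r// gt_eqF.
pose E1 := [set w | 24 * M%:R <= absum B w].
pose E2 := [set w | absum B w <= q / 64 * M%:R].
have mE1 : measurable E1.
  rewrite -[X in measurable X]setTI; exact: (measurable_fun_ler _ (measurable_absum B)).
have mE2 : measurable E2.
  rewrite -[X in measurable X]setTI; exact: (measurable_fun_ler (measurable_absum B)).
apply: (@le_trans _ _ (P (E1 `|` E2))).
  apply: le_measure; rewrite ?inE//; [exact: measurable_bad|exact: measurableU|].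
  move=> w; rewrite /bad /E1 /E2 /= negb_and -!ltNge AB -/a ![_ * a]mulrC !ltr_pM2l//.
  by case/orP => /ltW; [right|left].
apply: le_trans (measureU2 _ _ _) _ => //.
apply: le_trans (leeD (absum_up B1) (absum_low B1)) _.
rewrite -EFinD lee_fin.
have : expR (- M%:R) <= expR (- (rate * M%:R)) :> R.
  rewrite ler_expR lerN2 ler_piMl// /rate expr2.
  by have := ler_wpM2r (ltW q0) q1; move: q0 q1; lra.
lra.
Qed.

End single_matrix.

(** * Uniformity over low-rank matrices *)

Section grid.
Variable R : realType.

Definition gridv N (i : 'I_(2 * N).+1) : R := (i%:R - N%:R) / N%:R.

Lemma gridv_le1 N (i : 'I_(2 * N).+1) : (0 < N)%N -> `|gridv i| <= 1.
Proof.
move=> N0; have NR : 0 < N%:R :> R by rewrite ltr0n.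
rewrite normrM normfV (ger0_norm (ltW NR)) ler_pdivrMr// mul1r ler_norml.
have : i%:R <= (2 * N)%:R :> R by rewrite ler_nat -ltnS.
rewrite natrM => h; have := ler0n R i; lra.
Qed.

Lemma grid_approx N (x : R) : (0 < N)%N -> `|x| <= 1 ->
  exists i : 'I_(2 * N).+1, `|x - gridv i| <= N%:R^-1.
Proof.
move=> N0; have NR : 0 < N%:R :> R by rewrite ltr0n.
rewrite ler_norml => /andP[x1 x2].
pose y := (x + 1) * N%:R.
have y0 : 0 <= y by rewrite mulr_ge0//; lra.
have /andP[t1 t2] := truncn_itv y0.
have tN : (Num.truncn y < (2 * N).+1)%N.
  rewrite ltnS -(ler_nat R) (le_trans t1)// natrM ler_wpM2r//; lra.
exists (Ordinal tN); rewrite /gridv /=.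
have -> : x - ((Num.truncn y)%:R - N%:R) / N%:R = (y - (Num.truncn y)%:R) / N%:R.
  by rewrite /y; field; rewrite gt_eqF.
rewrite normrM normfV (ger0_norm (ltW NR)) ler_pdivrMr// mulVf ?gt_eqF//.
move: t2; rewrite -natr1 => t2; rewrite ger0_norm; lra.
Qed.

Definition grid_prod n k N (z : 'M['I_(2 * N).+1]_(n, k) * 'M['I_(2 * N).+1]_(n, k)) :
  'M[R]_n := map_mx (@gridv N) z.1 *m (map_mx (@gridv N) z.2)^T.

Lemma card_grid n k N :
  #|{: 'M['I_(2 * N).+1]_(n, k) * 'M['I_(2 * N).+1]_(n, k)}| =
  ((2 * N).+1 ^ (n * k * 2))%N.
Proof. by rewrite card_prod !card_mx card_ord mulnn -expnM. Qed.

(** Unit Frobenius norm bounds the singular values by 1, so they can be multiplied into one factor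
    and all entries stay in [-1, 1]. This box does not depend on A, which makes a finite grid
    possible. *)
Lemma low_rank_factor n k (A : 'M[R]_n) : frob2 A = 1 -> (\rank A <= k)%N ->
  exists X Y : 'M[R]_(n, k), [/\ forall i j, `|X i j| <= 1,
    forall i j, `|Y i j| <= 1 & A = X *m Y^T].
Proof.
move=> A1 rA; have [U [V [s [Uo Vo s0 AE]]]] := svd A.
have s1 : \sum_i s 0 i ^+ 2 = 1 by rewrite -A1 AE frob2_ortho// frob2_diag.
have rs : (nnz s <= k)%N by rewrite -(rank_svd s Uo Vo) -AE.
pose l := [seq i <- enum 'I_n | s 0 i != 0].
have sl : (size l <= k)%N.
  by rewrite size_filter -sum1_count big_enum_cond /= sum1_card.
have ent (W : 'M[R]_n) i j : W^T *m W = 1%:M -> `|W i j| <= 1.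
  move=> Wo; rewrite -(@expr_le1 _ 2)// real_normK ?num_real//.
  rewrite -(sqn_col_ortho j Wo) /sqn (bigD1 i)//= mxE lerDl.
  by apply: sumr_ge0 => ? _; exact: sqr_ge0.
have ss i : `|s 0 i| <= 1.
  rewrite -(@expr_le1 _ 2)// real_normK ?num_real// -s1 (bigD1 i)//= lerDl.
  by apply: sumr_ge0 => ? _; exact: sqr_ge0.
(* Columns beyond the support are padded with zeros. The row index is the default of [nth], and is
   never reached since j < size l. *)
exists (\matrix_(a, j) if (j < size l)%N then U a (nth a l j) else 0).
exists (\matrix_(b, j) if (j < size l)%N then s 0 (nth b l j) * V b (nth b l j) else 0).
split.
- by move=> a j; rewrite mxE; case: ifP => _; rewrite ?normr0// ent.
- move=> b j; rewrite mxE; case: ifP => _; rewrite ?normr0// normrM.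
  by rewrite mulr_ile1// ent.
rewrite [LHS]AE; apply/matrixP => a b; rewrite !mxE.
transitivity (\sum_(i <- l) U a i * (s 0 i * V b i)).
  rewrite big_filter big_enum_cond /= [RHS]big_mkcond /=.
  apply: eq_bigr => i _; rewrite mul_mx_diag !mxE -mulrA.
  by case: eqP => // ->; rewrite mul0r mulr0.
rewrite (big_nth a) big_mkord (big_ord_widen k (fun j => U a (nth a l j) * (s 0 (nth a l j) * V b (nth a l j))))//.
rewrite big_mkcond; apply: eq_bigr => j _; rewrite !mxE; case: ifP => jl; last by rewrite mul0r.
by rewrite (set_nth_default b).
Qed.

Lemma grid_cover n k N (A : 'M[R]_n) : (0 < N)%N -> frob2 A = 1 -> (\rank A <= k)%N ->
  exists z, frob2 (A - @grid_prod n k N z) <= (n%:R * (2 * k%:R / N%:R)) ^+ 2.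
Proof.
move=> N0 A1 rA; have [X [Y [X1 Y1 AE]]] := low_rank_factor A1 rA.
have NR : 0 < N%:R :> R by rewrite ltr0n.
have /choice[f hf] : forall ij : 'I_n * 'I_k, exists i : 'I_(2 * N).+1, `|X ij.1 ij.2 - gridv i| <= N%:R^-1.
  by move=> ij; exact: grid_approx.
have /choice[g hg] : forall ij : 'I_n * 'I_k, exists i : 'I_(2 * N).+1, `|Y ij.1 ij.2 - gridv i| <= N%:R^-1.
  by move=> ij; exact: grid_approx.
exists (\matrix_(i, j) f (i, j), \matrix_(i, j) g (i, j)).
have entry i j : (A - grid_prod (\matrix_(i, j) f (i, j), \matrix_(i, j) g (i, j))) i j ^+ 2 <=
    (2 * k%:R / N%:R) ^+ 2.
  rewrite -[leLHS]real_normK ?num_real// ler_pXn2r ?nnegrE ?mulr_ge0 ?invr_ge0//.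
  rewrite AE /grid_prod !mxE -sumrB; apply: le_trans (ler_norm_sum _ _ _) _.
  apply: (@le_trans _ _ (\sum_(l < k) (2 / N%:R))); last first.
    by rewrite sumr_const card_ord -[leLHS]mulr_natr [leLHS]mulrAC.
  apply: ler_sum => l _; rewrite !mxE.
  have h1 := hf (i, l); have h2 := hg (j, l); rewrite /= in h1 h2.
  have g1 := gridv_le1 (f (i, l)) N0.
  set x := X i l in h1 *; set y := Y j l in h2 *.
  set x' := gridv (f (i, l)) in h1 g1 *; set y' := gridv (g (j, l)) in h2 *.
  have y1 : `|y| <= 1 := Y1 j l.
  clearbody x y x' y'.
  have -> : x * y - x' * y' = (x - x') * y + x' * (y - y') by ring.
  apply: le_trans (ler_normD _ _) _; rewrite !normrM.
  have := ler_pM (normr_ge0 (x - x')) (normr_ge0 y) h1 y1.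
  have := ler_pM (normr_ge0 x') (normr_ge0 (y - y')) g1 h2.
  by move=> a1 a2; lra.
apply: (@le_trans _ _ (\sum_(i < n) \sum_(j < n) (2 * k%:R / N%:R) ^+ 2)).
  by apply: ler_sum => i _; apply: ler_sum => j _; exact: entry.
rewrite !sumr_const card_ord -mulrnA -[leLHS]mulr_natl natrM -expr2.
by rewrite -exprMn.
Qed.

End grid.

(** * From the grid to all matrices of low rank *)

Section uniform_bound.
Variables (R : realType) (n : nat).
Let V := borel_cV R n.

Lemma sqn_mulmx_le (B : 'M[R]_n) (y : 'cV[R]_n) : sqn (B *m y) <= frob2 B * sqn y.
Proof.
rewrite /frob2 mulr_suml; apply: ler_sum => i _.
have -> : (B *m y) i 0 = dotv (row i B)^T y.
  by rewrite mxE; apply: eq_bigr => j _; rewrite !mxE.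
apply: le_trans (cauchy_schwarz _ _) _; rewrite le_eqVlt; apply/orP; left; apply/eqP.
by congr (_ * _); apply: eq_bigr => j _; rewrite !mxE.
Qed.

Lemma bil_le (B : 'M[R]_n) (x y : V) : sqn (x : 'cV[R]_n) = 1 -> sqn (y : 'cV[R]_n) = 1 ->
  `|bil B (x, y)| <= n%:R * Num.sqrt (frob2 B).
Proof.
move=> x1 y1; rewrite /bil normrM normr_nat ler_wpM2l//= -sqrtr_sqr ler_wsqrtr//.
apply: le_trans (cauchy_schwarz _ _) _; rewrite x1 mul1r.
by apply: le_trans (sqn_mulmx_le _ _) _; rewrite y1 mulr1.
Qed.

Variables (d : measure_display) (Omega : measurableType d) (P : probability Omega R).
Variables (M : nat) (u v : 'I_M -> {RV P >-> borel_cV R n}).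
Variable q : R.
Hypotheses (q0 : 0 < q) (q1 : 256 * q <= 1).

Lemma absumD A B w : absum u v (A + B) w <= absum u v A w + absum u v B w.
Proof.
rewrite -big_split; apply: ler_sum => i _ /=; apply: le_trans (ler_normD _ _).
by rewrite /bil mulmxDl dotvDr mulrDr.
Qed.

Lemma absumN A w : absum u v (- A) w = absum u v A w.
Proof. by rewrite -scaleN1r absumZ normrN1 mul1r. Qed.

Lemma absum_le B w :
  (forall i, sqn (u i w : 'cV[R]_n) = 1) -> (forall i, sqn (v i w : 'cV[R]_n) = 1) ->
  absum u v B w <= n%:R * Num.sqrt (frob2 B) * M%:R.
Proof.
move=> u1 v1; rewrite mulr_natr -[X in _ *+ X]card_ord -sumr_const.
by apply: ler_sum => i _; exact: bil_le.
Qed.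

(** A minus its grid neighbour B may have rank above k, so it is controlled by the crude bound
    [absum_le] instead, which loses a factor n; hence a mesh with N of order n^2 k. Then n |A - B|_F
    <= q/512 and 1/2 <= |B|_F <= 2, and the constants follow from q/128 - q/512 >= q/256 and 48 +
    q/512 <= 49. *)
Lemma uniform_absum (k N : nat) w : (0 < n)%N -> (0 < N)%N -> 1024 * n%:R ^+ 2 * k%:R <= q * N%:R ->
  (forall i, sqn (u i w : 'cV[R]_n) = 1) -> (forall i, sqn (v i w : 'cV[R]_n) = 1) ->
  (forall z, ~ bad u v q (@grid_prod R n k N z) w) ->
  forall A, (\rank A <= k)%N ->
    q / 256 * M%:R * Num.sqrt (frob2 A) <= absum u v A w <=
    49 * M%:R * Num.sqrt (frob2 A).
Proof.
move=> n0 N0 Nq u1 v1 nbad.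
have NR : 0 < N%:R :> R by rewrite ltr0n.
have M0 : 0 <= M%:R :> R by rewrite ler0n.
have unit A : frob2 A = 1 -> (\rank A <= k)%N ->
    q / 256 * M%:R <= absum u v A w <= 49 * M%:R.
  move=> A1 rA; have [z hz] := @grid_cover R n k N A N0 A1 rA.
  have := nbad z; rewrite /bad /= => /negP; rewrite negbK => /andP[].
  set B := grid_prod R z in hz *; set b := Num.sqrt (frob2 B).
  pose dl := Num.sqrt (frob2 (A - B)).
  have dl0 : 0 <= dl by exact: sqrtr_ge0.
  have b0 : 0 <= b by exact: sqrtr_ge0.
  have b2 : b ^+ 2 = frob2 B by rewrite sqr_sqrtr// frob2_ge0.
  have dl2 : dl ^+ 2 = frob2 (A - B) by rewrite sqr_sqrtr// frob2_ge0.
  have dlN : n%:R * dl <= q / 512.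
    have h : dl <= n%:R * (2 * k%:R / N%:R).
      rewrite -(@ler_pXn2r _ 2)// ?nnegrE ?mulr_ge0 ?invr_ge0//.
      by rewrite dl2.
    apply: le_trans (ler_wpM2l _ h) _; first by rewrite ler0n.
    rewrite -(ler_pM2r NR).
    have -> : n%:R * (n%:R * (2 * k%:R / N%:R)) * N%:R = 1024 * n%:R ^+ 2 * k%:R / 512 :> R.
      by field; rewrite gt_eqF.
    lra.
  have n1 : 1 <= n%:R :> R by rewrite ler1n.
  have dl1 : dl <= 1 / 4.
    have : dl <= n%:R * dl by rewrite ler_peMl.
    move: q1; lra.
  have AB : 1 <= 2 * b ^+ 2 + 2 * dl ^+ 2.
    by have := frob2D_le (A - B) B; rewrite subrK A1 b2 dl2; lra.
  have BA : b ^+ 2 <= 2 + 2 * dl ^+ 2.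
    have sy : frob2 (B - A) = frob2 (A - B).
      by do 2 (apply: eq_bigr => ? _); rewrite !mxE -sqrrN opprB.
    by have := frob2D_le (B - A) A; rewrite subrK A1 sy b2 dl2; lra.
  have dls : dl ^+ 2 <= 1 / 16 by nra.
  have b12 : 1 / 2 <= b by nra.
  have b22 : b <= 2 by nra.
  move=> lo up.
  have h1 : absum u v (A - B) w <= q / 512 * M%:R.
    by apply: le_trans (absum_le _ u1 v1) _; rewrite ler_wpM2r.
  have h2 : absum u v B w <= absum u v A w + absum u v (A - B) w.
    rewrite -[absum u v (A - B) w]absumN opprB; apply: le_trans (absumD _ _ _).
    by rewrite addrC subrK.
  have h3 : absum u v A w <= absum u v B w + absum u v (A - B) w.
    by apply: le_trans (absumD _ _ _); rewrite addrC subrK.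
  have qM : 0 <= q * M%:R by rewrite mulr_ge0// ltW.
  have l1 := ler_wpM2l qM b12; have l2 := ler_wpM2l M0 b22.
  have l3 : q * M%:R <= M%:R by rewrite ler_piMl//; move: q1 q0; lra.
  apply/andP; split; lra.
move=> A rA; have [->|A0] := eqVneq A 0.
  have -> : frob2 (0 : 'M[R]_n) = 0 by apply/eqP; rewrite frob2_eq0.
  by rewrite sqrtr0 !mulr0 -(scale0r (0 : 'M[R]_n)) absumZ normr0 mul0r lexx.
have F0 : 0 < frob2 A by rewrite lt_def frob2_eq0 A0 frob2_ge0.
set a := Num.sqrt (frob2 A); have a0 : 0 < a by rewrite sqrtr_gt0.
pose B := a^-1 *: A.
have B1 : frob2 B = 1.
  transitivity (a^-1 ^+ 2 * frob2 A).
    rewrite /frob2 mulr_sumr; apply: eq_bigr => i _; rewrite mulr_sumr.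
    by apply: eq_bigr => j _; rewrite mxE exprMn.
  by rewrite exprVn sqr_sqrtr ?frob2_ge0// mulVf// gt_eqF.
have -> : absum u v A w = absum u v B w * a.
  by rewrite absumZ ger0_norm ?invr_ge0 ?ltW// mulrC mulrA divff ?mul1r// gt_eqF.
rewrite !ler_pM2r//; apply: unit => //.
exact: leq_trans (mxrank_scale _ _) rA.
Qed.

End uniform_bound.

Section good_event.
Context d (Omega : measurableType d) (R : realType) (P : probability Omega R).
Context (n M : nat) (u v : 'I_M -> {RV P >-> borel_cV R n}).
Hypotheses (n0 : (0 < n)%N) (ind : mutually_independent (joint_family u v)).
Hypothesis uu : forall i, uniform_on_sphere (distribution P (u i)).
Hypothesis uv : forall i, uniform_on_sphere (distribution P (v i)).

Lemma measure_bigcup_fin_le (I : finType) (F : I -> set Omega) (e : R) :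
  (forall i, measurable (F i)) -> (forall i, P (F i) <= e%:E)%E ->
  measurable (\bigcup_i F i) /\ (P (\bigcup_i F i) <= (#|I|%:R * e)%:E)%E.
Proof.
move=> mF Fe.
rewrite (_ : \bigcup_i F i = \big[setU/set0]_(i <- enum I) F i); last first.
  by rewrite -bigcup_seq; apply: eq_bigcupl; split => i //= _; rewrite mem_enum.
rewrite cardE; elim: (enum I) => [|i l [IHm IH]].
  by rewrite big_nil mul0r measure0.
rewrite big_cons; split; first exact: measurableU.
apply: le_trans (measureU2 _ _ _) _ => //.
by rewrite /= -natr1 mulrDl mul1r addrC EFinD leeD.
Qed.

(** The vectors lie on the sphere only almost surely, while [absum_le] is a pointwise bound. *)
Lemma sphere_event : exists S : set Omega, [/\ measurable S, P S = 0%E &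
  forall w, ~ S w -> (forall i, sqn (u i w : 'cV[R]_n) = 1) /\
                     (forall i, sqn (v i w : 'cV[R]_n) = 1)].
Proof.
pose N (k : 'I_M + 'I_M) := joint_family u v k @^-1` (~` @unit_sphere R n).
have mN k : measurable (N k).
  rewrite -[X in measurable X]setTI; apply: measurable_funPT => //.
  by apply: measurableC; exact: measurable_sphere.
have N0 k : (P (N k) <= 0%:E)%E.
  have [h] : uniform_on_sphere (distribution P (joint_family u v k)) by case: k.
  move=> _; rewrite -[P _]/(distribution P (joint_family u v k) (~` @unit_sphere R n)).
  rewrite probability_setC; last exact: measurable_sphere.
  by move: h => ->; rewrite subee.
have [mU U0] := measure_bigcup_fin_le mN N0.
exists (\bigcup_k N k); split => //.
  by apply/eqP; rewrite eq_le measure_ge0 andbT; rewrite mulr0 in U0.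
move=> w nS; split => i; apply: contrapT => h; apply: nS.
  by exists (inl i).
by exists (inr i).
Qed.

(** A measurable exceptional set is exhibited, made of the null set off the sphere and the finitely
    many bad grid events. The exact failure set ranges over uncountably many A. *)
Lemma good_event (q : R) (k N : nat) : 0 < q -> 256 * q <= 1 ->
  (0 < N)%N -> 1024 * n%:R ^+ 2 * k%:R <= q * N%:R ->
  exists B : set Omega, [/\ measurable B,
    (P B <= (((2 * N).+1 ^ (n * k * 2))%:R * (2 * expR (- (q ^+ 2 / 512 * M%:R))))%R%:E)%E &
    forall w, ~ B w -> forall A, (\rank A <= k)%N ->
      q / 256 * M%:R * Num.sqrt (frob2 A) <= absum u v A w <=
      49 * M%:R * Num.sqrt (frob2 A)].
Proof.
move=> q0 q1 N0 Nq; have [S [mS S0 hS]] := sphere_event.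
have [] := @measure_bigcup_fin_le _ (fun z => bad u v q (@grid_prod R n k N z))
  (2 * expR (- (q ^+ 2 / 512 * M%:R))).
- by move=> z; exact: measurable_bad.
- by move=> z; exact: prob_bad_le.
set U := \bigcup_z _ => mU PU.
exists (S `|` U); split; first exact: measurableU.
  apply: le_trans (measureU2 _ mS mU) _; rewrite -[leRHS]add0e; apply: leeD.
    by rewrite -S0.
  by rewrite -card_grid.
move=> w /not_orP[nS nU]; have [u1 v1] := hS _ nS.
by apply: (uniform_absum q0 q1 n0 N0 Nq u1 v1) => z hz; apply: nU; exists z.
Qed.

End good_event.

(** * Measurability of recovery *)

Section recovery.
Variables (R : realType) (n : nat).
Let V := borel_cV R n.

Definition l1n (B : 'M[R]_n) : R := \sum_i \sum_j `|B i j|.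

Lemma l1n_ge0 B : 0 <= l1n B.
Proof. by do 2 (apply: sumr_ge0 => ? _). Qed.

Lemma l1nN B : l1n (- B) = l1n B.
Proof. by do 2 (apply: eq_bigr => ? _); rewrite mxE normrN. Qed.

Lemma mx_subE (A B : 'M[R]_n) i j : (A - B) i j = A i j - B i j.
Proof. by rewrite !mxE. Qed.

(** An orthogonal polar factor Q of A attains the trace norm of A; against B it gives at most the
    trace norm of B, and the entries of Q are at most 1 in absolute value. *)
Lemma trace_norm_lip (A B : 'M[R]_n) : trace_norm A <= trace_norm B + l1n (A - B).
Proof.
have [U [W [s [Uo Wo s0 AE]]]] := svd A.
pose Q := U *m W^T.
have Qo : Q^T *m Q = 1%:M by apply: orthoM => //; exact: orthoT.
have -> : trace_norm A = \tr (Q^T *m A).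
  rewrite AE trace_norm_svd// /Q trmx_mul trmxK -!mulmxA mxtrace_mulC -!mulmxA Wo mulmx1.
  by rewrite mulmxA Uo mul1mx mxtrace_diag.
rewrite -[A in \tr (_ *m A)](subrK B) addrC mulmxDr mxtraceD lerD//.
  by apply: trace_norm_dual; exact: contraction_ortho.
rewrite /mxtrace /l1n exchange_big; apply: ler_sum => j _.
rewrite mxE; apply: ler_sum => i _; rewrite mxE.
apply: le_trans (ler_norm _) _; rewrite normrM ler_piMl//.
rewrite -(@expr_le1 _ 2)// real_normK ?num_real//.
rewrite -(sqn_col_ortho j Qo) /sqn (bigD1 i)//= [X in _ <= X ^+ 2 + _]mxE lerDl.
by apply: sumr_ge0 => ? _; exact: sqr_ge0.
Qed.

Lemma lip_continuous m (f : 'rV[R]_m -> R) (g : 'rV[R]_m -> 'rV[R]_m -> R) :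
  (forall x y, f x <= f y + g x y) -> (forall x y, g x y = g y x) ->
  (forall x, continuous (g x)) -> (forall x, g x x = 0) -> continuous f.
Proof.
move=> fg gC cg g0 x; apply/(@cvgrPdist_lt _ _ _ (nbhs x) (nbhs_filter x)) => e e0.
have : \forall y \near x, `|g x x - g x y| < e.
  exact: (@cvgr_dist_lt _ _ _ (nbhs x) (nbhs_filter x) (g x) (g x x) (cg x x) _ e0).
apply: filterS => y; rewrite g0 sub0r normrN => gy.
apply: le_lt_trans gy; apply: le_trans (ler_norm _).
have h1 := fg x y; have h2 := fg y x; rewrite gC in h2.
rewrite ler_norml; lra.
Qed.

Lemma continuous_vec_mx i j : continuous (fun z : 'rV[R]_(n * n) => (vec_mx z : 'M[R]_n) i j).
Proof. by under eq_fun do rewrite mxE; exact: coord_continuous. Qed.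

Lemma continuous_norm_sub (f : 'rV[R]_(n * n) -> R) c : continuous f -> continuous (fun z => `|c - f z|).
Proof.
move=> cf x; apply: (@continuous_comp _ _ _ (fun z => c - f z) (fun y => `|y|)).
  by apply: continuousB; [exact: cst_continuous|exact: cf].
exact: norm_continuous.
Qed.

Lemma continuous_trace_norm (H : 'M[R]_n) :
  continuous (fun z : 'rV[R]_(n * n) => trace_norm (H + vec_mx z)).
Proof.
apply: (@lip_continuous _ _ (fun x y => l1n (vec_mx x - vec_mx y))).
- move=> x y; apply: le_trans (trace_norm_lip _ (H + vec_mx y)) _.
  by rewrite opprD addrACA subrr add0r.
- by move=> x y; rewrite -opprB l1nN.
- move=> x; apply: continuous_sumr => i; apply: continuous_sumr => j.
  have -> : (fun y : 'rV[R]_(n * n) => `|(vec_mx x - vec_mx y) i j|) =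
      (fun y => `|(vec_mx x : 'M[R]_n) i j - (vec_mx y : 'M[R]_n) i j|).
    by apply/funext => y; rewrite mx_subE.
  by apply: continuous_norm_sub; exact: continuous_vec_mx.
- by move=> x; rewrite subrr /l1n big1// => i _; rewrite big1// => j _; rewrite mxE normr0.
Qed.

Lemma continuous_frob2 : continuous (fun z : 'rV[R]_(n * n) => frob2 (vec_mx z : 'M[R]_n)).
Proof.
apply: continuous_sumr => i; apply: continuous_sumr => j.
by apply: continuous_exprn; exact: continuous_vec_mx.
Qed.

Variables (d : measure_display) (Omega : measurableType d) (P : probability Omega R).
Variables (M : nat) (u v : 'I_M -> {RV P >-> borel_cV R n}).

(** The constant may depend on w, since measurability concerns every w, including those with vectors
    off the sphere. *)
Lemma absum_lip w : exists c, 0 <= c /\ forall A, absum u v A w <= c * l1n A.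
Proof.
pose l (x : V) := \sum_(i < n) `|(x : 'cV[R]_n) i 0|.
have l0 x : 0 <= l x by apply: sumr_ge0.
have lx (x : V) i : `|(x : 'cV[R]_n) i 0| <= l x.
  by rewrite /l (bigD1 i)//= lerDl sumr_ge0.
exists (\sum_(i < M) n%:R * (l (u i w) * l (v i w))); split.
  by apply: sumr_ge0 => i _; rewrite !mulr_ge0.
move=> A; rewrite mulr_suml; apply: ler_sum => i _.
rewrite /bil normrM normr_nat -mulrA ler_wpM2l//= /dotv mulr_sumr.
apply: le_trans (ler_norm_sum _ _ _) _; apply: ler_sum => a _.
rewrite normrM -mulrA ler_pM//.
rewrite mxE mulr_sumr; apply: le_trans (ler_norm_sum _ _ _) _; apply: ler_sum => b _.
by rewrite normrM mulrC ler_wpM2r//; exact: lx.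
Qed.

Lemma continuous_absum w : continuous (fun z : 'rV[R]_(n * n) => absum u v (vec_mx z) w).
Proof.
apply: continuous_sumr => i x.
apply: (@continuous_comp _ _ _ (fun z => bil (vec_mx z) (u i w, v i w)) (fun y => `|y|)).
  move: x; apply: continuous_mulr; first exact: cst_continuous.
  apply: continuous_sumr => a; apply: continuous_mulr; first exact: cst_continuous.
  have -> : (fun z : 'rV[R]_(n * n) => ((vec_mx z : 'M[R]_n) *m (v i w : 'cV[R]_n)) a 0) =
    (fun z => \sum_b (vec_mx z : 'M[R]_n) a b * (v i w : 'cV[R]_n) b 0).
    by apply/funext => z; rewrite mxE.
  apply: continuous_sumr => b; apply: continuous_mulr; last exact: cst_continuous.
  exact: continuous_vec_mx.
exact: norm_continuous.
Qed.

Lemma dense_rat_mx (A : 'M[R]_n) e : 0 < e -> exists B : 'M[rat]_n, l1n (map_mx ratr B - A) < e.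
Proof.
move=> e0; pose e' := e / (n%:R * n%:R + 1).
have n1 : 0 < n%:R * n%:R + 1 :> R by rewrite ltr_pwDr// mulr_ge0.
have e'0 : 0 < e' by rewrite divr_gt0.
have /choice[f hf] : forall ij : 'I_n * 'I_n, exists r : rat, `|ratr r - A ij.1 ij.2| <= e'.
  move=> [i j] /=; have [r] : exists r : rat, ratr r \in `]A i j - e', A i j + e'[.
    by apply: rat_in_itvoo; lra.
  rewrite in_itv /= => /andP[h1 h2]; exists r; rewrite ler_norml; lra.
exists (\matrix_(i, j) f (i, j)).
apply: (@le_lt_trans _ _ (n%:R * n%:R * e')).
  have -> : n%:R * n%:R * e' = \sum_(i < n) \sum_(j < n) e'.
    by rewrite !sumr_const card_ord -mulrnA -natrM mulr_natl.
  by do 2 (apply: ler_sum => ? _); rewrite !mxE; exact: hf (_, _).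
by rewrite /e' mulrA ltr_pdivrMr// mulrC ltr_pM2l// ltrDl.
Qed.

(** Bounds away from 0 and infinity make each shell compact, and the shells exhaust the nonzero Z
    that do not increase the trace norm. *)
Definition cone_shell (H : 'M[R]_n) (m : nat) := [set Z : 'M[R]_n |
  [/\ m.+1%:R^-1 <= frob2 Z, frob2 Z <= m.+1%:R & trace_norm (H + Z) <= trace_norm H]].

Lemma compact_shell H m : compact [set z : 'rV[R]_(n * n) | cone_shell H m (vec_mx z)].
Proof.
apply: (@compact_rV _ _ _ (m.+1%:R + 1)).
  rewrite (_ : [set z | _] =
    ((fun z : 'rV[R]_(n * n) => frob2 (vec_mx z : 'M[R]_n)) @^-1` [set x | m.+1%:R^-1 <= x]) `&`
    (((fun z : 'rV[R]_(n * n) => frob2 (vec_mx z : 'M[R]_n)) @^-1` [set x | x <= m.+1%:R]) `&`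
    ((fun z : 'rV[R]_(n * n) => trace_norm (H + vec_mx z)) @^-1` [set x | x <= trace_norm H]))); last first.
    by apply/seteqP; split => z /=; [move=> [h1 h2 h3]|move=> [h1 [h2 h3]]].
  apply: closedI; last apply: closedI.
  - by move/continuous_closedP : continuous_frob2; apply; exact: closed_ge.
  - by move/continuous_closedP : continuous_frob2; apply; exact: closed_le.
  - by move/continuous_closedP : (@continuous_trace_norm H); apply; exact: closed_le.
move=> z [_ h _] k; case/mxvec_indexP : k => i j.
have <- : (vec_mx z : 'M[R]_n) i j = z 0 (mxvec_index i j) by rewrite mxE.
have : `|(vec_mx z : 'M[R]_n) i j| ^+ 2 <= m.+1%:R.
  rewrite real_normK ?num_real//; apply: le_trans h.
  rewrite /frob2 (bigD1 i)//= (bigD1 j)//= -addrA lerDl addr_ge0//.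
    by apply: sumr_ge0 => ? _; exact: sqr_ge0.
  by do 2 (apply: sumr_ge0 => ? _); exact: sqr_ge0.
by have := normr_ge0 ((vec_mx z : 'M[R]_n) i j); have := ler0n R m.+1; nra.
Qed.

(* Compactness of the shell replaces the exact kernel condition by countably many
   inequalities over rational matrices. *)
Lemma shell_kernel H m w :
  (exists Z, cone_shell H m Z /\ absum u v Z w = 0) <->
  (forall q : nat, exists B : 'M[rat]_n,
    (exists Z, cone_shell H m Z /\ l1n (map_mx ratr B - Z) < q.+1%:R^-1) /\
    absum u v (map_mx ratr B) w < q.+1%:R^-1).
Proof.
have [c [c0 hc]] := absum_lip w.
have c1 : 0 < c + 1 by lra.
split => [[Z [KZ Z0]] q|h].
  have q0 : 0 < q.+1%:R^-1 :> R by rewrite invr_gt0.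
  have e0 : 0 < q.+1%:R^-1 / (c + 1) by rewrite divr_gt0.
  have [B hB] := dense_rat_mx Z e0.
  have hB' : (c + 1) * l1n (map_mx ratr B - Z) < q.+1%:R^-1.
    by rewrite mulrC -ltr_pdivlMr.
  have l0 := l1n_ge0 (map_mx ratr B - Z).
  have cl := mulr_ge0 c0 l0.
  have lq : l1n (map_mx ratr B - Z) < q.+1%:R^-1.
    by apply: le_lt_trans hB'; rewrite mulrDl mul1r lerDr.
  have cq : c * l1n (map_mx ratr B - Z) < q.+1%:R^-1.
    by apply: le_lt_trans hB'; rewrite mulrDl mul1r lerDl.
  exists B; split; first by exists Z; split.
  rewrite -[map_mx ratr B](subrK Z); apply: le_lt_trans (absumD _ _ _ _ _) _.
  by rewrite Z0 addr0; apply: le_lt_trans (hc _) _.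
pose K := [set z : 'rV[R]_(n * n) | cone_shell H m (vec_mx z)].
(* The case q = 0 supplies a point of the shell, so [absum] has a minimizer there; the rational
   matrices then push the minimum below every e > 0. *)
have K0 : K !=set0.
  by have [B [[Z [KZ _]] _]] := h 0%N; exists (mxvec Z); rewrite /K /= mxvecK.
have [z /set_mem Kz zmin] := compact_EVT_min K0 (@compact_shell H m)
  (continuous_subspaceT (@continuous_absum w)).
exists (vec_mx z); split => //.
apply/eqP; rewrite eq_le; apply/andP; split; last by apply: sumr_ge0.
apply/ler_addgt0Pr => e e0; rewrite add0r.
have [q hq] : exists q : nat, (c + 1) * q.+1%:R^-1 < e.
  have [q hq] := ltr_add_invr (y := 0) (x := e / (c + 1)) (divr_gt0 e0 c1).
  by exists q; rewrite mulrC -ltr_pdivlMr//; move: hq; rewrite add0r.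
have [B [[Z [KZ lZ]] aB]] := h q.
move: (q.+1%:R^-1) hq lZ aB => p hq lZ aB.
have := zmin (mxvec Z); rewrite mxvecK => /(_ _)/le_trans; apply.
  by rewrite inE /K /= mxvecK.
have -> : Z = map_mx ratr B + - (map_mx ratr B - Z) by rewrite opprB addrC subrK.
apply: le_trans (absumD _ _ _ _ _) _; rewrite absumN.
have := hc (map_mx ratr B - Z); have := ler_wpM2l c0 (ltW lZ); lra.
Qed.

Lemma measurable_shell_kernel H m :
  measurable [set w | exists Z, cone_shell H m Z /\ absum u v Z w = 0].
Proof.
pose F q (B : 'M[rat]_n) := [set w | (exists Z, cone_shell H m Z /\ l1n (map_mx ratr B - Z) < q.+1%:R^-1) /\
    absum u v (map_mx ratr B) w < q.+1%:R^-1].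
rewrite (_ : [set w | _] = \bigcap_q \bigcup_k (if unpickle k is Some B then F q B else set0)); last first.
  apply/seteqP; split => w /=.
    move=> /shell_kernel h q _; have [B hB] := h q.
    by exists (pickle B) => //; rewrite pickleK.
  move=> h; apply/shell_kernel => q; have [k _] := h q I.
  by case: unpickle => // B FB; exists B.
apply: bigcapT_measurable => q; apply: bigcupT_measurable => k.
case: unpickle => // B.
(* The existential condition does not involve w, so it either drops out or empties the set. *)
have [hZ|hZ] := pselect (exists Z, cone_shell H m Z /\ l1n (map_mx ratr B - Z) < q.+1%:R^-1).
  rewrite (_ : F q B = [set w | absum u v (map_mx ratr B) w < q.+1%:R^-1]); last first.
    by apply/seteqP; split => w; rewrite /F /=; [case|split].
  rewrite -[X in measurable X]setTI.
  exact: (measurable_fun_ltr (measurable_absum u v _)).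
rewrite (_ : F q B = set0)//; apply/seteqP; split => w; rewrite /F /=; by [case|].
Qed.

(** The trace pairing of Z with its image is the mean of the squares of [bil], so it vanishes only
    if every u_i^T Z v_i does. *)
Lemma sampling_map_eq0 w Z : (0 < n)%N -> (0 < M)%N ->
  (sampling_map (fun i => u i w : 'cV[R]_n) (fun i => v i w : 'cV[R]_n) Z = 0) <->
  absum u v Z w = 0.
Proof.
move=> n0 M0; have MR : M%:R^-1 != 0 :> R by rewrite invr_eq0 pnatr_eq0 -lt0n.
have E i : rank_one_map (u i w : 'cV[R]_n) (v i w : 'cV[R]_n) Z =
    (n%:R * bil Z (u i w, v i w)) *: ((u i w : 'cV[R]_n) *m (v i w : 'cV[R]_n)^T).
  rewrite /rank_one_map /bil /=; move: (u i w : 'cV[R]_n) (v i w : 'cV[R]_n) => x y.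
  have -> : x *m x^T *m Z *m (y *m y^T) = x *m (x^T *m (Z *m y)) *m y^T.
    by rewrite !mulmxA.
  by rewrite dotvE mul_mx_scalar -scalemxAl scalerA mulrA expr2.
split => [S0|a0].
  have : \tr (Z^T *m sampling_map (fun i => u i w : 'cV[R]_n) (fun i => v i w : 'cV[R]_n) Z) = 0.
    by rewrite S0 mulmx0 mxtrace0.
  rewrite /sampling_map -scalemxAr mxtraceZ => /eqP; rewrite mulf_eq0 (negbTE MR) /=.
  rewrite mulmx_sumr raddf_sum /=.
  rewrite (eq_bigr (fun i => bil Z (u i w, v i w) ^+ 2)); last first.
    move=> i _; rewrite E -scalemxAr mxtraceZ /bil /=.
    move: (u i w : 'cV[R]_n) (v i w : 'cV[R]_n) => x y.
    rewrite mulmxA mxtrace_mulC mulmxA.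
    have -> : \tr (y^T *m Z^T *m x) = dotv x (Z *m y).
      by rewrite -trmx_mul dotvE mxtrace_scalar dotvC.
    by ring.
  rewrite psumr_eq0; last by move=> i _; exact: sqr_ge0.
  move=> /allP h; rewrite /absum big1// => i _.
  by have := h i (mem_index_enum _); rewrite /= sqrf_eq0 => /eqP ->; rewrite normr0.
rewrite /sampling_map big1 ?scaler0// => i _; rewrite E.
have /psumr_eq0P /(_ i isT)/eqP : absum u v Z w = 0 by [].
by rewrite normr_eq0 => /(_ _)/eqP -> //; rewrite mulr0 scale0r.
Qed.

Let smp w := sampling_map (fun i => u i w : 'cV[R]_n) (fun i => v i w : 'cV[R]_n).

Lemma sampling_mapD w A B : smp w (A + B) = smp w A + smp w B.
Proof.
rewrite /smp /sampling_map -scalerDr -big_split; congr (_ *: _); apply: eq_bigr => i _ /=.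
by rewrite /rank_one_map mulmxDr mulmxDl scalerDr.
Qed.

Lemma unique_minimizerP w (H : 'M[R]_n) :
  (forall X, is_minimizer (smp w) H X <-> X = H) <->
  (forall Z, Z != 0 -> smp w Z = 0 -> trace_norm H < trace_norm (H + Z)).
Proof.
split => [h Z Z0 SZ|h X].
  rewrite ltNge; apply/negP => HZ.
  have [_ Hmin] := (h H).2 erefl.
  have /h : is_minimizer (smp w) H (H + Z).
    split; first by rewrite sampling_mapD SZ addr0.
    by move=> Y /Hmin; exact: le_trans.
  by move/eqP; rewrite -[eqbRHS]addr0 (inj_eq (addrI _)) (negbTE Z0).
have min Y : smp w Y = smp w H -> Y != H -> trace_norm H < trace_norm Y.
  move=> SY YH; have -> : Y = H + (Y - H) by rewrite addrC subrK.
  apply: h; first by rewrite subr_eq0.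
  have : smp w ((Y - H) + H) = smp w H by rewrite subrK.
  by rewrite sampling_mapD -[RHS]add0r => /addIr.
split => [[SX Xmin]|->].
  apply/eqP; apply: contraT => XH.
  by have := min _ SX XH; rewrite ltNge Xmin.
by split => // Y SY; have [->|YH] := eqVneq Y H; last exact: ltW (min _ SY YH).
Qed.

Lemma measurable_recovery (H : 'M[R]_n) : (0 < n)%N -> (0 < M)%N ->
  measurable [set w | forall X, is_minimizer (smp w) H X <-> X = H].
Proof.
move=> n0 M0.
rewrite (_ : [set w | _] = ~` \bigcup_m [set w | exists Z, cone_shell H m Z /\ absum u v Z w = 0]).
  by apply: measurableC; apply: bigcupT_measurable => m; exact: measurable_shell_kernel.
apply/seteqP; split => w /=.
  move=> /unique_minimizerP h [m _ [Z [[h1 h2 h3] /(sampling_map_eq0 _ _ n0 M0) SZ]]].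
  have : trace_norm H < trace_norm (H + Z).
    apply: h => //; rewrite -frob2_eq0 gt_eqF//; apply: lt_le_trans h1.
    by rewrite invr_gt0.
  by rewrite ltNge h3.
move=> h; apply/unique_minimizerP => Z Z0 SZ; rewrite ltNge; apply/negP => HZ; apply: h.
have F0 : 0 < frob2 Z by rewrite lt_def frob2_eq0 Z0 frob2_ge0.
pose t := Num.max (frob2 Z) (frob2 Z)^-1.
exists (Num.truncn t) => //; exists Z; split; last exact/(sampling_map_eq0 _ _ n0 M0).
have tm : t < (Num.truncn t).+1%:R by exact: truncnS_gt.
have := tm; rewrite /t gt_max -/t => /andP[t1 t2].
split => //; last exact: ltW.
by rewrite invf_ple ?posrE// ltW.
Qed.

End recovery.

(** * Choice of constants *)

Section numerics.
Variable R : realType.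

Lemma ln_ge_half (n : nat) : (2 <= n)%N -> 1 / 2 <= ln n%:R :> R.
Proof.
move=> n2; have n0 : 0 < n%:R :> R by rewrite ltr0n; apply: leq_trans n2.
rewrite -[leLHS]expRK ler_ln ?posrE ?expR_gt0//.
apply: (@le_trans _ _ 2); last by rewrite (ler_nat R 2 n).
rewrite -[expR _]invrK -expRN -[leRHS]invrK lef_pV2 ?posrE ?expR_gt0 ?invr_gt0//.
have := expR_ge1Dx (- (1 / 2) : R); lra.
Qed.

Lemma leq_wexp2r (a b e : nat) : (a <= b)%N -> (a ^ e <= b ^ e)%N.
Proof. by case: e => // e ab; rewrite leq_exp2r. Qed.

(** Everything becomes a power of n: 2^b <= n^b absorbs the constants, n^3 the mesh factor n^2 and r
    <= n. The extra 2 n <= n^2 pays for the two tails and for the target probability 1/n. *)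
Lemma card_bound (b D K n r : nat) : (3 * D * (K + 2) <= 2 ^ b)%N -> (2 <= n)%N ->
  (0 < r <= n)%N -> (0 < D)%N ->
  ((2 * (D * n ^ 2 * ((K + 2) * r))).+1 ^ (n * ((K + 2) * r) * 2) * 2 * n <=
   n ^ ((b + 3) * (n * ((K + 2) * r) * 2) + 2))%N.
Proof.
move=> hb n2 /andP[r0 rn] D0; set e := (n * _ * 2)%N.
have n0 : (0 < n)%N by apply: leq_trans n2.
set N := (D * n ^ 2 * ((K + 2) * r))%N.
have N0 : (0 < N)%N by rewrite !muln_gt0 D0 n0 r0 addn2.
have h : ((2 * N).+1 <= n ^ (b + 3))%N.
  apply: (@leq_trans (3 * N)); first by lia.
  apply: (@leq_trans (3 * D * (K + 2) * n ^ 3)).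
    have -> : (3 * N = 3 * D * (K + 2) * (n ^ 2 * r))%N by rewrite /N; lia.
    by rewrite (expnSr n 2) !leq_mul.
  rewrite expnD leq_mul//; apply: leq_trans hb _.
  by rewrite leq_wexp2r.
rewrite expnD expnM -mulnA leq_mul//; first by rewrite leq_wexp2r.
by rewrite -mulnn leq_mul.
Qed.

(** The entropy exponent E ln n is below Q n r ln n, where the 3 in Q against the 2 in E gives
    strictness. The hypothesis on M supplies this times 2 r ln n, and r ln n >= 1/2 is why C carries
    a factor 2. *)
Lemma tail_lt_inv (rho C : R) (b D K n r M : nat) : 0 < rho ->
  C = 2 * (2 * (b + 3) * (K + 2) + 3)%:R / rho ->
  (3 * D * (K + 2) <= 2 ^ b)%N -> (2 <= n)%N -> (0 < r <= n)%N -> (0 < D)%N ->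
  C * n%:R * r%:R ^+ 2 * ln n%:R ^+ 2 <= M%:R ->
  ((2 * (D * n ^ 2 * ((K + 2) * r))).+1 ^ (n * ((K + 2) * r) * 2))%:R *
    (2 * expR (- (rho * M%:R))) < n%:R^-1.
Proof.
move=> rho0 CE hb n2 rn D0 hM.
have n0 : (0 < n)%N by apply: leq_trans n2.
have nR : 0 < n%:R :> R by rewrite ltr0n.
have := card_bound hb n2 rn D0.
set A := (_ ^ _)%N; set E := ((b + 3) * _ + 2)%N => hA.
have lnn := ln_ge_half n2.
rewrite -div1r ltr_pdivlMr//.
apply: (@le_lt_trans _ _ ((n ^ E)%:R * expR (- (rho * M%:R)))).
  have -> : A%:R * (2 * expR (- (rho * M%:R))) * n%:R = (A * 2 * n)%:R * expR (- (rho * M%:R)) :> R.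
    by rewrite !natrM; ring.
  by rewrite ler_wpM2r ?expR_ge0// ler_nat.
have -> : (n ^ E)%:R = expR (E%:R * ln n%:R) :> R by rewrite expRM_natl lnK ?posrE// natrX.
rewrite -expRD expR_lt1 subr_lt0.
case/andP: rn => r0 rn.
have r1 : 1 <= r%:R :> R by rewrite ler1n.
set Q := (2 * (b + 3) * (K + 2) + 3)%N in CE.
have EQ : (E < Q * (n * r))%N.
  have nr : (0 < n * r)%N by rewrite muln_gt0 n0.
  rewrite /E /Q; lia.
have EQ' : E%:R < Q%:R * (n%:R * r%:R) :> R by rewrite -!natrM ltr_nat.
have l0 : 0 < ln n%:R :> R by lra.
apply: (@lt_le_trans _ _ (Q%:R * (n%:R * r%:R) * ln n%:R)); first by rewrite ltr_pM2r.
apply: le_trans (ler_wpM2l (ltW rho0) hM); rewrite CE.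
have -> : rho * (2 * Q%:R / rho * n%:R * r%:R ^+ 2 * ln n%:R ^+ 2) =
   (Q%:R * (n%:R * r%:R) * ln n%:R) * (2 * (r%:R * ln n%:R)).
  by field; rewrite gt_eqF.
rewrite ler_peMr//; first by rewrite !mulr_ge0// ltW.
have := ler_wpM2r (ltW l0) r1; lra.
Qed.

Lemma trace_norm_gt0 n (Z : 'M[R]_n) : Z != 0 -> trace_norm (0 : 'M[R]_n) < trace_norm Z.
Proof.
have [U [V [s [Uo Vo s0 ->]]]] := svd Z => Z0.
rewrite trace_norm_svd//.
have -> : trace_norm (0 : 'M[R]_n) = 0.
  have -> : 0 = 1%:M *m diag_mx 0 *m 1%:M^T :> 'M[R]_n by rewrite linear0 mulmx0 mul0mx.
  rewrite trace_norm_svd ?trmx1 ?mulmx1//; last by move=> i; rewrite mxE.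
  by rewrite big1// => i _; rewrite mxE.
rewrite lt_def sumr_ge0// andbT; apply: contra_neq Z0 => /psumr_eq0P h.
have -> : s = 0 by apply/rowP => i; rewrite mxE h.
by rewrite linear0 mulmx0 mul0mx.
Qed.

(** For n = 1 the logarithm vanishes and M may be 1; a single sample already detects a nonzero
    scalar. *)
Lemma bil_dim1_neq0 n (Z : 'M[R]_n) (x y : 'cV[R]_n) : (n <= 1)%N ->
  sqn x = 1 -> sqn y = 1 -> Z != 0 -> bil Z (x, y) != 0.
Proof.
case: n Z x y => [|[|//]] Z x y _; first by rewrite [Z]flatmx0 eqxx.
rewrite /sqn /bil /dotv !big_ord1 mxE big_ord1 => x1 y1 Z0.
rewrite !mulf_neq0 ?oner_neq0//=.
- by rewrite -sqrf_eq0 x1 oner_neq0.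
- by apply: contra_neq Z0 => h; apply/matrixP => i j; rewrite !ord1 mxE.
- by rewrite -sqrf_eq0 y1 oner_neq0.
Qed.

End numerics.

Section probability_bounds.
Context d (Omega : measurableType d) (R : realType) (P : probability Omega R).

Lemma prob_ge_compl (A B : set Omega) (e : R) : measurable A -> measurable B ->
  (P B <= e%:E)%E -> ~` B `<=` A -> ((1 - e)%:E <= P A)%E.
Proof.
move=> mA mB Be BA.
apply: (@le_trans _ _ (P (~` B))); last first.
  by apply: le_measure => //; rewrite inE//; exact: measurableC.
by rewrite probability_setC// EFinB leeB.
Qed.

End probability_bounds.

Theorem theorem1 (R : realType) :
  exists C : R,
  forall (n : nat) (H : 'M[R]_n) (M : nat) (d : measure_display)
    (Omega : measurableType d) (P : probability Omega R)
    (u v : 'I_M -> {RV P >-> borel_cV R n}),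
    (0 < n)%N ->
    H^T = H ->
    (0 < M)%N ->
    mutually_independent (joint_family u v) ->
    (forall i, uniform_on_sphere (distribution P (u i))) ->
    (forall i, uniform_on_sphere (distribution P (v i))) ->
    C * n%:R * (\rank H)%:R ^+ 2 * ln n%:R ^+ 2 <= M%:R ->
    let recovery := [set w : Omega | forall X : 'M[R]_n,
      is_minimizer (sampling_map (fun i => u i w) (fun i => v i w)) H X <->
      X = H] in
    measurable recovery /\ ((1 - n%:R^-1)%:E < P recovery)%E.
Proof.
have [q [q0 q1]] : exists q : R, 0 < q /\ 256 * q <= 1.
  by exists (1 / 256); split; lra.
(* 49 and q/256 are the constants of [uniform_absum], up to the common factor M. D then fixes the
   mesh N = D n^2 k, and b turns the constants into a power of 2. *)
have [K Kc] : exists K : nat, 2 * (1 + (49 / (q / 256)) ^+ 2) < K%:R.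
  by exists (Num.truncn (2 * (1 + (49 / (q / 256)) ^+ 2))).+1; exact: truncnS_gt.
have [D Dq] : exists D : nat, 1024 <= q * D%:R.
  exists (Num.truncn (1024 / q)).+1.
  by rewrite mulrC -ler_pdivrMr//; apply/ltW/truncnS_gt.
have [b hb] : exists b : nat, (3 * D * (K + 2) <= 2 ^ b)%N.
  by exists (3 * D * (K + 2))%N; exact/ltnW/ltn_expl.
have rho0 : 0 < q ^+ 2 / 512 by apply: divr_gt0; [exact: exprn_gt0|lra].
exists (2 * (2 * (b + 3) * (K + 2) + 3)%:R / (q ^+ 2 / 512)).
move=> n H M d Omega P u v n0 _ M0 ind uu uv hM recovery.
have mrec : measurable recovery by exact: measurable_recovery.
split => //.
have recP w : (forall Z, Z != 0 -> absum u v Z w = 0 -> trace_norm H < trace_norm (H + Z)) ->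
    recovery w.
  move=> h; apply/unique_minimizerP => Z Z0 /(sampling_map_eq0 u v w Z n0 M0); exact: h.
have all_good : (forall w, recovery w) -> ((1 - n%:R^-1)%:E < P recovery)%E.
  move=> h; rewrite (_ : recovery = setT); last by apply/seteqP; split.
  by rewrite probability_setT lte_fin gtrBl invr_gt0 ltr0n.
(* At rank 0 the bound on M is 0, and recovery is deterministic: 0 alone has the least trace
   norm. *)
have [H0|H0] := eqVneq H 0.
  apply: all_good => w; apply: recP => Z Z0 _.
  by rewrite H0 add0r; exact: trace_norm_gt0.
have nR : 0 < n%:R :> R by rewrite ltr0n.
have [n1|n2] := leqP n 1.
  have [S [mS S0 hS]] := sphere_event uu uv.
  apply: (@lt_le_trans _ _ (1 - 0)%:E); first by rewrite lte_fin ltrD2l ltrN2 invr_gt0.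
  apply: (prob_ge_compl mrec mS); first by rewrite S0.
  move=> w nS; apply: recP => Z Z0 aZ; have [u1 v1] := hS w nS.
  have := bil_dim1_neq0 n1 (u1 (Ordinal M0)) (v1 (Ordinal M0)) Z0.
  move: aZ; rewrite /absum => /eqP; rewrite psumr_eq0// => /allP/(_ (Ordinal M0)).
  by rewrite mem_index_enum normr_eq0 => /(_ isT)/implyP/(_ isT) ->.
have rn : (0 < \rank H <= n)%N by rewrite lt0n mxrank_eq0 H0 rank_leq_row.
have D0 : (0 < D)%N.
  by rewrite lt0n; apply/eqP => D0; move: Dq; rewrite D0 mulr0; lra.
have K0 : (0 < K)%N.
  rewrite lt0n; apply/eqP => K0; move: Kc; rewrite K0.
  have := sqr_ge0 (49 / (q / 256)); lra.
pose k := ((K + 2) * \rank H)%N; pose N := (D * n ^ 2 * k)%N.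
have k0 : (0 < k)%N by rewrite muln_gt0 addn2; case/andP: rn.
have N0 : (0 < N)%N by rewrite muln_gt0 k0 muln_gt0 D0 expn_gt0 n0.
have NqE : 1024 * n%:R ^+ 2 * k%:R <= q * N%:R.
  rewrite /N natrM natrM (natrX _ n 2) !mulrA.
  by rewrite ler_wpM2r// !ler_wpM2r.
have [B [mB PB hB]] := good_event n0 ind uu uv q0 q1 N0 NqE.
have lt := tail_lt_inv rho0 erefl hb n2 rn D0 hM.
apply: lt_le_trans (prob_ge_compl mrec mB PB _).
  by rewrite lte_fin ltrD2l ltrN2.
move=> w nB; apply: recP => Z Z0 aZ.
have MR : 0 < M%:R :> R by rewrite ltr0n.
(* M cancels from c2 / c1, which is what allows K to be fixed before n, H and M. *)
have c12 : 49 * M%:R / (q / 256 * M%:R) = 49 / (q / 256).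
  by field; rewrite !gt_eqF.
apply: (@deterministic_recovery R n H Z (fun A => absum u v A w) (q / 256 * M%:R) (49 * M%:R) K) => //.
- by rewrite mulr_gt0// divr_gt0.
- by rewrite c12.
- by move=> A B'; exact: absumD.
- by move=> A; exact: absumN.
- exact: hB.
Qed.
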